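(* Let $\epsilon=(\alpha,\beta,\gamma)$ be a one-face embedding of a graph $G$ and $\nu$ a vertex of $G$ with $k=deg(\nu)$. Let $D_\nu$ be the diagonal of the localization of $\epsilon$ at $\nu$ and suppose $D_\nu$ has cycle type $(1^{a_1},2^{a_2},\ldots,k^{a_k})$. Then the probability $prob_1(\nu)$ that a reembedding of $\nu$ yields a one-face embedding satisfies $$\frac{2}{deg(\nu)-a_1+2}\leq prob_1(\nu)\leq\frac{2}{deg(\nu)-a_1+\frac{19}{29}}.$$ In particular, $prob_1(\nu)\geq\frac{2}{deg(\nu)+2}$ for every vertex $\nu$.
   Context: A map with $m$ edges is a triple $(\alpha,\beta,\gamma)$ of permutations of $[2m]$ (half-edges), $\alpha$ a fixed-point-free involution (edges), cycles of $\beta$ the cyclic orders of half-edges at vertices, $\gamma=\alpha\beta$ (composition $(\sigma\tau)(x)=\sigma(\tau(x))$), whose cycles are the faces; one-face means $\gamma$ is a single cycle. The graph is $G=(\alpha,Par_\beta)$, vertices are the blocks of $Par_\beta$ (partition into cycles of $\beta$), $deg(\nu)=|\nu|$. Localization at $\nu$: let $s_\nu$ be the permutation of $\nu$ with $s_\nu(v)=\gamma^j(v)$ where $j\geq1$ is least with $\gamma^j(v)\in\nu$, let $\pi_\nu=\beta|_\nu$, and $D_\nu=s_\nu\circ\pi_\nu^{-1}$. A reembedding of $\nu$ is a permutation $\beta'$ with $\beta'(x)=\beta(x)$ for $x\notin\nu$ and $\beta'|_\nu$ a single cycle on $\nu$; there are $(deg(\nu)-1)!$ of them (including $\beta$). $prob_1(\nu)$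 is the number of reembeddings $\beta'$ for which $\alpha\beta'$ is a single cycle, divided by $(deg(\nu)-1)!$. *)

(* Defs.v *)
From HB Require Import structures.
From mathcomp Require Import all_boot all_order all_algebra all_fingroup.

Set Implicit Arguments.
Unset Strict Implicit.
Unset Printing Implicit Defensive.

(* Permutations are composed from left to right in MathComp:
   (s * t)%g x = t (s x).  The composite "s after t" is thus (t * s)%g. *)

Record graph (m : nat) := Graph {
  graph_edges : {perm 'I_(2 * m)};
  vertices : {set {set 'I_(2 * m)}};
  graph_edgesK : involutive graph_edges;
  graph_edges_fpf : forall x, graph_edges x != x;
  vertices_partition : partition vertices [set: 'I_(2 * m)]
}.

Record cmap (m : nat) := CMap {
  edge_perm : {perm 'I_(2 * m)};
  vertex_perm : {perm 'I_(2 * m)};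
  face_perm : {perm 'I_(2 * m)};
  edge_permK : involutive edge_perm;
  edge_perm_fpf : forall x, edge_perm x != x;
  face_permE : face_perm = (vertex_perm * edge_perm)%g
}.

Definition single_cycle (T : finType) (g : {perm T}) : bool :=
  #|porbits g| == 1.

Definition one_face (m : nat) (e : cmap m) : bool := single_cycle (face_perm e).

Definition embedding_of (m : nat) (G : graph m) (e : cmap m) : Prop :=
  edge_perm e = graph_edges G /\ porbits (vertex_perm e) = vertices G.

Definition deg (T : finType) (nu : {set T}) : nat := #|nu|.

Section FirstReturn.
Variables (T : finType) (g : {perm T}) (A : {set T}).

Lemma first_return_ex (x : T) :
  x \in A -> exists j, (0 < j) && ((g ^+ j)%g x \in A).
Proof.
by move=> xA; exists #[g]%g; rewrite order_gt0 expg_order perm1.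
Qed.

Definition first_return (x : T) : T :=
  match @idP (x \in A) with
  | ReflectT xA => (g ^+ ex_minn (first_return_ex xA))%g x
  | ReflectF _ => x
  end.

Lemma first_return_out (x : T) : x \notin A -> first_return x = x.
Proof. by rewrite /first_return; case: {-}_ / idP => // xA /negP. Qed.

Lemma first_return_in (x : T) : x \in A ->
  exists j, [/\ 0 < j, first_return x = (g ^+ j)%g x, first_return x \in A
    & forall i, 0 < i -> (g ^+ i)%g x \in A -> j <= i].
Proof.
rewrite /first_return; case: {-}_ / idP => // xA _.
case: ex_minnP => j /andP[j0 jA] jmin; exists j; split=> // i i0 iA.
by apply: jmin; rewrite i0.
Qed.

Lemma first_return_inj : injective first_return.
Proof.
have aux x y i j : x \in A -> i <= j -> (g ^+ i)%g x = (g ^+ j)%g y ->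
    (forall l, 0 < l -> (g ^+ l)%g y \in A -> j <= l) -> 0 < i -> x = y.
  move=> xA leij; rewrite -{1}(subnK leij) expgD permM => /perm_inj xE jmin i0.
  have [lt|] := ltnP i j; last first.
    by rewrite -subn_eq0 => /eqP ij0; rewrite xE ij0 expg0 perm1.
  have := jmin (j - i); rewrite subn_gt0 lt -xE xA => /(_ isT isT).
  by rewrite leqNgt ltn_subrL i0 (leq_trans i0 leij).
move=> x y; have [xA|xA] := boolP (x \in A); have [yA|yA] := boolP (y \in A).
- have [i [i0 -> _ imin]] := first_return_in xA.
  have [j [j0 -> _ jmin]] := first_return_in yA.
  move=> E; have [le|/ltnW le] := leqP i j; first exact: aux E jmin i0.
  by apply/esym; apply: aux (esym E) imin j0.
- have [_ [_ _ + _]] := first_return_in xA.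
  by rewrite (first_return_out yA) => + E; rewrite E (negPf yA).
- have [_ [_ _ + _]] := first_return_in yA.
  by rewrite (first_return_out xA) => + E; rewrite -E (negPf xA).
by rewrite !first_return_out.
Qed.

Definition first_return_perm : {perm T} := perm first_return_inj.

End FirstReturn.

(* A permutation of nu is encoded as a permutation of the half-edges which
   fixes every half-edge outside nu. *)

Definition local_face (m : nat) (e : cmap m) (nu : {set 'I_(2 * m)}) :
    {perm 'I_(2 * m)} :=
  first_return_perm (face_perm e) nu.

Definition local_vertex (m : nat) (e : cmap m) (nu : {set 'I_(2 * m)}) :
    {perm 'I_(2 * m)} :=
  restr_perm nu (vertex_perm e).

Definition diagonal (m : nat) (e : cmap m) (nu : {set 'I_(2 * m)}) :
    {perm 'I_(2 * m)} :=
  ((local_vertex e nu)^-1 * local_face e nu)%g.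

Lemma diagonal_on (m : nat) (e : cmap m) (nu : {set 'I_(2 * m)}) :
  perm_on nu (diagonal e nu).
Proof.
apply: perm_onM; first exact/perm_onV/restr_perm_on.
apply/subsetP=> x; rewrite inE permE; apply: contraR => xnu.
by rewrite first_return_out.
Qed.

(* Only the cycles contained in A are counted, so the fixed points of s
   outside A do not contribute. *)
Definition num_cycles (T : finType) (A : {set T}) (s : {perm T}) (i : nat) :
    nat :=
  #|[set C in porbits s | (C \subset A) && (#|C| == i)]|.

(* (1^(a 1), 2^(a 2), ..., k^(a k)); the values of a outside 1..k are
   irrelevant. *)
Definition has_cycle_type (k : nat) (T : finType) (A : {set T}) (s : {perm T})
    (a : nat -> nat) : Prop :=
  forall i, 0 < i <= k -> num_cycles A s i = a i.

Definition reembedding (m : nat) (e : cmap m) (nu : {set 'I_(2 * m)})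
    (b : {perm 'I_(2 * m)}) : bool :=
  [forall x, (x \notin nu) ==> (b x == vertex_perm e x)]
  && (nu \in porbits b).

Definition prob1 (m : nat) (e : cmap m) (nu : {set 'I_(2 * m)}) : rat :=
  (#|[set b : {perm 'I_(2 * m)} |
       reembedding e nu b && single_cycle (b * edge_perm e)%g]|%:R
   / ((deg nu).-1`!)%:R)%R.

(* Main.v *)
(* Write nu as A, of size n, and let N be the number of full cycles c of A such
   that D c is again a full cycle; following the face permutation from one visit
   of nu to the next shows that prob_1(nu) = N / (n-1)!. Expand the indicator of
   the full cycles as n [s is a full cycle] = sum_S (n - |S|) (-1)^(cycles of s
   in S) over the s-stable subsets S of A and sum over c first: all S cancel
   except those for which D S differs from S by one point, and a second double
   count leads to n (n+1) N = sum_(S D-stable) sgn(D|S) |S|! (n - |S|)!. By the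
   beta integral this means
     prob_1(nu) = int_0^1 prod_i p_(l_i)(t) dt,  p_l(t) = (1-t)^l - (-t)^l,
   where the l_i are the cycle lengths of D; p_1 = 1, so that fixed points do
   not contribute. As D is even the integrand is symmetric under t -> 1 - t, and
   on [0, 1/2] all factors are nonnegative. If P is the product for the lengths
   l_i >= 2, of sum n, integrating ((1 - 2t) P)' and bounding (1 - 2t) P' below by
   - n P gives the lower bound. For the upper bound, two lengths a, b may be
   replaced by 3, a + b - 3, which increases P, and removing a length 3 gives a
   recursive inequality between the integrals for n and n - 3. *)
Require Import Defs.
From mathcomp Require Import all_boot all_order all_algebra all_fingroup.
From mathcomp Require Import polyrcf realalg zify ring lra.

Set Implicit Arguments.
Unset Strict Implicit.
Unset Printing Implicit Defensive.

Import Order.TTheory GRing.Theory Num.Theory.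

(** * Cycles inside a set *)

Section CyclesInSet.
Variable T : finType.
Implicit Types (s t : {perm T}) (A S C : {set T}) (x y : T).

Definition stable S s := s @: S == S.

Lemma stableP S s : reflect (forall x, (s x \in S) = (x \in S)) (stable S s).
Proof.
apply: (iffP eqP) => [E x|E]; first by rewrite -{1}E mem_imset //; apply: perm_inj.
apply/eqP; rewrite eqEcard card_imset ?leqnn ?andbT; last exact: perm_inj.
by apply/subsetP=> _ /imsetP[x xS ->]; rewrite E.
Qed.

Lemma stable_astabs S s : stable S s = (s \in 'N(S | 'P))%g.
Proof. by apply/stableP/astabsP. Qed.

Lemma perm_on_stable A s : perm_on A s -> stable A s.
Proof. by rewrite /stable => /im_perm_on ->. Qed.

Lemma stableV S s : stable S s -> stable S s^-1%g.
Proof. by rewrite !stable_astabs groupV. Qed.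

Lemma stableM S s t : stable S s -> stable S t -> stable S (s * t)%g.
Proof. by rewrite !stable_astabs; apply: groupM. Qed.

Lemma stableD A S s : stable A s -> stable S s -> stable (A :\: S) s.
Proof. by move=> /stableP As /stableP Ss; apply/stableP=> x; rewrite !inE As Ss. Qed.

Lemma stable_porbit_sub S s x : stable S s -> (porbit s x \subset S) = (x \in S).
Proof.
move/stableP=> Ss; apply/subsetP/idP=> [|xS y /porbitP[i ->]].
  by apply; apply: porbit_id.
by elim: i => [|i]; rewrite ?expg0 ?perm1 // expgSr permM Ss.
Qed.

Lemma porbit_stable s x : stable (porbit s x) s.
Proof.
apply/stableP=> y; rewrite -!eq_porbit_mem.
by have := porbit_perm s 1 y; rewrite expg1 => ->.
Qed.

(** The parity of the permutation induced on a stable [S]. If [S] is not stable, [restr_perm S s] is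
    the identity and the value is [false]. *)
Definition restr_odd S s : bool := restr_perm S s.

Lemma restr_stableE S s x : stable S s -> x \in S -> restr_perm S s x = s x.
Proof. by rewrite stable_astabs => Ss xS; rewrite restr_permE. Qed.

Lemma restr_out S s x : x \notin S -> restr_perm S s x = x.
Proof. by move=> xS; rewrite (out_perm (restr_perm_on _ _)). Qed.

Lemma restr_stableM S s t : stable S s -> stable S t ->
  restr_perm S (s * t)%g = (restr_perm S s * restr_perm S t)%g.
Proof. by rewrite !stable_astabs => Ss St; rewrite morphM. Qed.

Lemma restr_oddM S s t : stable S s -> stable S t ->
  restr_odd S (s * t)%g = restr_odd S s (+) restr_odd S t.
Proof. by move=> Ss St; rewrite /restr_odd restr_stableM // odd_permM. Qed.

Lemma restr_perm_on_id A s : perm_on A s -> restr_perm A s = s.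
Proof.
move=> As; apply/permP=> x; have [xA|xA] := boolP (x \in A).
  by rewrite restr_stableE // perm_on_stable.
by rewrite restr_out // (out_perm As).
Qed.

Definition num_porbits_in S s : nat := #|[set C in porbits s | C \subset S]|.

Lemma porbit_out A s x : perm_on A s -> x \notin A -> porbit s x = [set x].
Proof.
move=> As xA; apply/setP=> y; rewrite inE; apply/porbitP/eqP => [[i ->]|->].
  by rewrite permX_fix // (out_perm As).
by exists 0; rewrite expg0 perm1.
Qed.

Lemma card_porbits_perm_on A s : perm_on A s ->
  #|porbits s| = num_porbits_in A s + #|~: A|.
Proof.
move=> As; rewrite -(cardsID [set C : {set T} | C \subset A]); congr (_ + _).
  by apply: eq_card => C; rewrite !inE.
rewrite -(card_imset (mem (~: A)) set1_inj); apply: eq_card => C.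
rewrite !inE; apply/andP/imsetP => [[CA /imsetP[x _ Cx]]|[x xA ->]].
  move: CA; rewrite Cx stable_porbit_sub ?perm_on_stable // => xA.
  by exists x; rewrite ?inE // (porbit_out As).
rewrite inE in xA; rewrite sub1set; split=> //.
by apply/imsetP; exists x => //; rewrite (porbit_out As).
Qed.

Lemma porbit_restr S s x : stable S s -> x \in S -> porbit (restr_perm S s) x = porbit s x.
Proof.
move=> Ss xS; suff E i : (restr_perm S s ^+ i)%g x = (s ^+ i)%g x.
  by apply/setP=> y; apply/porbitP/porbitP => -[i ->]; exists i; rewrite E.
elim: i => [|i IHi]; first by rewrite !expg0.
rewrite !expgSr !permM IHi restr_stableE //.
have := stable_porbit_sub x Ss; rewrite xS => /subsetP; apply.
exact: mem_porbit.
Qed.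

Lemma num_porbits_restr S s : stable S s ->
  num_porbits_in S (restr_perm S s) = num_porbits_in S s.
Proof.
move=> Ss; apply: eq_card => C; rewrite !inE.
have Sr := perm_on_stable (restr_perm_on S s).
apply/andP/andP=> -[/imsetP[x _ ->]]; rewrite stable_porbit_sub // => xS.
  by rewrite porbit_restr // xS imset_f.
by rewrite -(porbit_restr Ss) // xS imset_f.
Qed.

Lemma odd_restr S s : stable S s ->
  restr_odd S s = odd #|S| (+) odd (num_porbits_in S s).
Proof.
move=> Ss; rewrite /restr_odd /odd_perm (card_porbits_perm_on (restr_perm_on S s)).
by rewrite num_porbits_restr // -(cardsC S) !oddD addbACA addbb addbF.
Qed.

Lemma num_porbits_disjointU A S s : stable A s -> stable S s -> S \subset A ->
  num_porbits_in A s = num_porbits_in S s + num_porbits_in (A :\: S) s.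
Proof.
move=> As Ss SA; rewrite /num_porbits_in -(cardsID [set C : {set T} | C \subset S]); congr (_ + _).
  apply: eq_card => C; rewrite !inE; case: (C \subset S) / idP => CS; last by rewrite !andbF.
  by rewrite (subset_trans CS SA) !andbT.
apply: eq_card => C; rewrite !inE; apply/and3P/andP=> [[+ /imsetP[x _ Cx]]|[/imsetP[x _ Cx]]].
  rewrite Cx !stable_porbit_sub ?stableD //.
  by move=> xS xA; rewrite !inE xS xA imset_f.
rewrite Cx !stable_porbit_sub ?stableD // inE => /andP[xS xA].
by rewrite xS xA imset_f.
Qed.

Lemma num_porbits_in_gt0 S s x : stable S s -> x \in S -> 0 < num_porbits_in S s.
Proof.
move=> Ss xS; rewrite card_gt0; apply/set0Pn; exists (porbit s x).
by rewrite inE imset_f // stable_porbit_sub.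
Qed.

Lemma num_porbits_in0 s : num_porbits_in set0 s = 0.
Proof.
apply: eq_card0 => C; rewrite !inE; apply/andP=> -[/imsetP[x _ ->]].
by rewrite subset0 => /eqP /setP/(_ x); rewrite porbit_id inE.
Qed.

Lemma porbit_in_porbits C s x : C \in porbits s -> x \in C -> C = porbit s x.
Proof. by move=> /imsetP[y _ ->]; rewrite -eq_porbit_mem => /eqP. Qed.

Lemma mem_porbits_num A s : A != set0 -> stable A s ->
  (A \in porbits s) = (num_porbits_in A s == 1).
Proof.
move=> /set0Pn[x xA] As; apply/idP/cards1P => [Ao|[C EC]].
  exists A; apply/setP=> C; rewrite !inE; apply/andP/eqP=> [[Co]|-> //].
  have /set0Pn[y yC] : C != set0.
    by case/imsetP: Co => y _ ->; apply/set0Pn; exists y; apply: porbit_id.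
  by move=> /subsetP/(_ y yC); rewrite (porbit_in_porbits Co yC) => /(porbit_in_porbits Ao).
have mem y : y \in A -> porbit s y = C.
  by move=> yA; apply/set1P; rewrite -EC inE imset_f // stable_porbit_sub.
suff -> : A = porbit s x by rewrite imset_f.
apply/eqP; rewrite eqEsubset stable_porbit_sub // xA andbT.
by apply/subsetP=> y yA; rewrite (mem x) // -(mem y) // porbit_id.
Qed.

(** A transposition joins two cycles when [x] and [y] lie in different ones and splits their cycle
    when they share it; the doubled term covers both cases without subtraction. *)
Lemma num_porbits_tperm A s x y : perm_on A s -> x \in A -> y \in A -> x != y ->
  num_porbits_in A (tperm x y * s)%g + (x \notin porbit s y).*2 = (num_porbits_in A s).+1.
Proof.
move=> As xA yA xy; have tA : perm_on A (tperm x y).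
  by apply: subset_trans (tperm_on x y) _; apply/subsetP=> z; rewrite !inE => /orP[] /eqP->.
have /= := porbits_mul_tperm s x y; rewrite xy.
rewrite !(@card_porbits_perm_on A) ?perm_onM //; lia.
Qed.

Lemma stable_sub S s : {in S, forall x, s x \in S} -> stable S s.
Proof.
move=> sS; rewrite /stable eqEcard card_imset ?leqnn ?andbT; last exact: perm_inj.
by apply/subsetP=> _ /imsetP[x xS ->]; apply: sS.
Qed.

Lemma eq_restr S s t : stable S t -> {in S, s =1 t} -> restr_perm S s = restr_perm S t.
Proof.
move=> St E; have Ss : stable S s.
  by apply: stable_sub => x xS; rewrite E // (stableP _ _ St).
apply/permP=> x; have [xS|xS] := boolP (x \in S); last by rewrite !restr_out.
by rewrite !restr_stableE // E.
Qed.

(** * Permutations with one or two prescribed cycles *)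

Definition full_cycles A := [set s : {perm T} | perm_on A s & A \in porbits s].

(** Induction on [#|A|]: a full cycle of [A] arises in exactly one way from a full cycle [s] of
    [A :\ x] by inserting [x] between a point [y] and [s y], with [y] the preimage of [x]. There are
    [#|A| - 1] choices of [y]. *)
Lemma card_full_cycles A : A != set0 -> #|full_cycles A| = (#|A|.-1)`!.
Proof.
have [n] := ubnP #|A|; elim: n A => // n IHn A ltAn /set0Pn[x xA].
have EA := cardsD1 x A; rewrite xA in EA.
have [A0|A0] := eqVneq (A :\ x) set0.
  have {A0} -> : A = [set x].
    by apply/setP=> y; move/setP/(_ y): A0; rewrite !inE; case: eqP => // ->.
  rewrite cards1 /= fact0 -(cards1 (1%g : {perm T})); apply: eq_card => s.
  rewrite !inE; apply/andP/eqP=> [[As _]|->].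
    by apply: perm_on_id As _; rewrite cards1.
  by rewrite perm_on1 -(porbit_out (perm_on1 set0)) ?inE // imset_f.
pose f (p : T * {perm T}) : {perm T} := (tperm x p.1 * p.2)%g.
have fx y s : perm_on (A :\ x) s -> f (y, s) y = x.
  by move=> sA; rewrite permM tpermR (out_perm sA) // !inE eqxx.
have -> : full_cycles A = f @: setX (A :\ x) (full_cycles (A :\ x)).
  have key y s : y \in A :\ x -> perm_on (A :\ x) s ->
      (tperm x y * s)%g \in full_cycles A = (s \in full_cycles (A :\ x)).
    move=> yA sA; have [yx {}yA] := setD1P yA.
    have sA' : perm_on A s by apply: subset_trans sA (subD1set _ _).
    have tA : perm_on A (tperm x y).
      by apply: subset_trans (tperm_on x y) _; apply/subsetP=> z; rewrite !inE => /orP[] /eqP->.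
    have tsA : perm_on A (tperm x y * s)%g by rewrite perm_onM.
    rewrite !inE sA tsA /= !mem_porbits_num ?perm_on_stable //; last by apply/set0Pn; exists x.
    have := num_porbits_tperm sA' xA yA; rewrite eq_sym yx porbit_sym => /(_ isT).
    rewrite (porbit_out sA) ?inE ?eqxx // yx /=.
    have := card_porbits_perm_on sA; rewrite (card_porbits_perm_on sA').
    have := cardsC A; have := cardsC (A :\ x); lia.
  apply/setP=> s; apply/idP/imsetP => [sA|[[y t] /setXP[/= yA tA] ->]]; last first.
    by rewrite key //; move: tA; rewrite inE => /andP[].
  have [sA' Ao] := setIdP sA; set y := (s^-1)%g x.
  have yA : y \in A by rewrite perm_closed // perm_onV.
  have yx : y != x.
    apply: contra_neqN A0 => /eqP yx; have sx : s x = x by rewrite -{1}yx permKV.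
    have : porbit s x = A by rewrite -(porbit_in_porbits Ao xA).
    suff -> : porbit s x = [set x] by move <-; rewrite setDv.
    by apply/setP=> z; rewrite inE; apply/porbitP/eqP=> [[i ->]|->];
      [rewrite permX_fix | exists 0; rewrite expg0 perm1].
  have yA1 : y \in A :\ x by rewrite !inE yx.
  have tA : perm_on (A :\ x) (tperm x y * s)%g.
    apply/subsetP=> z; rewrite !inE permM => sz.
    have zx : z != x by apply: contraNneq sz => ->; rewrite tpermL permKV.
    rewrite zx /=; apply: contraNT sz => zA.
    have yz : y != z by apply: contraNneq zA => <-.
    by rewrite eq_sym in zx; rewrite tpermD // (out_perm sA').
  exists (y, tperm x y * s)%g; last by rewrite /f /= tpermKg.
  by rewrite inE /= yA1 -(key y) // tpermKg.
rewrite card_in_imset; last first.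
  move=> [y s] [z t] /setXP[/= yA /setIdP[sA _]] /setXP[/= zA /setIdP[tA _]] E.
  have yz : y = z by apply: (@perm_inj _ (f (y, s))); rewrite fx // E fx.
  by congr (_, _) => //; move: E; rewrite /f /= -yz => /mulgI.
rewrite cardsX IHn //; last by lia.
rewrite EA; have : 0 < #|A :\ x| by rewrite card_gt0.
by case: #|A :\ x| => // k _; rewrite factS.
Qed.

Lemma card_two_cycles A S : S \subset A -> S != set0 -> A :\: S != set0 ->
  #|[set s : {perm T} | [&& perm_on A s, S \in porbits s & A :\: S \in porbits s]]|
  = ((#|S|.-1)`! * (#|A :\: S|.-1)`!)%N.
Proof.
move=> SA S0 AS0; rewrite -!card_full_cycles // -cardsX.
pose f (p : {perm T} * {perm T}) : {perm T} := (p.1 * p.2)%g.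
have EA x : x \in A = (x \in S) || (x \in A :\: S).
  by rewrite inE; have := subsetP SA x; case: (x \in S) => // ->.
have fE1 s t x : perm_on (A :\: S) t -> perm_on S s -> x \in S -> f (s, t) x = s x.
  by move=> tA sS xS; rewrite permM /= (out_perm tA) // inE perm_closed // xS.
have fE2 s t x : perm_on S s -> x \notin S -> f (s, t) x = t x.
  by move=> sS xS; rewrite permM /= (out_perm sS).
have fstab s t : perm_on S s -> perm_on (A :\: S) t -> stable S (f (s, t)).
  move=> sS tA; apply/stableP=> x; have [xS|xS] := boolP (x \in S).
    by rewrite fE1 // perm_closed.
  rewrite fE2 //; have [xA|xA] := boolP (x \in A :\: S).
    by have := perm_closed x tA; rewrite xA inE => /andP[/negPf].
  by rewrite (out_perm tA) // (negPf xS).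
have fr1 s t : perm_on S s -> perm_on (A :\: S) t -> restr_perm S (f (s, t)) = s.
  move=> sS tA; apply/permP=> x; have [xS|xS] := boolP (x \in S).
    by rewrite restr_stableE ?fstab // fE1.
  by rewrite restr_out // (out_perm sS).
have fon s t : perm_on S s -> perm_on (A :\: S) t -> perm_on A (f (s, t)).
  by move=> sS tA; apply: perm_onM; [apply: subset_trans sS _ | apply: subset_trans tA (subsetDl _ _)].
have fr2 s t : perm_on S s -> perm_on (A :\: S) t -> restr_perm (A :\: S) (f (s, t)) = t.
  move=> sS tA; apply/permP=> x; have [xA|xA] := boolP (x \in A :\: S).
    rewrite restr_stableE ?stableD ?fstab //; first by rewrite fE2 //; case/setDP: xA.
    exact/perm_on_stable/fon.
  by rewrite restr_out // (out_perm tA).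
have mem_restr C s : C != set0 -> stable C s -> (C \in porbits s) = (restr_perm C s \in full_cycles C).
  move=> C0 Cs; rewrite inE restr_perm_on /= !mem_porbits_num ?num_porbits_restr //.
  exact/perm_on_stable/restr_perm_on.
rewrite -(@card_in_imset _ _ f); last first.
  move=> [s t] [s' t'] /setXP[/setIdP[sS _] /setIdP[tA _]] /setXP[/setIdP[sS' _] /setIdP[tA' _]] E.
  by congr (_, _); [rewrite -(fr1 s t) // E fr1 | rewrite -(fr2 s t) // E fr2].
apply: eq_card => s; rewrite inE; apply/and3P/imsetP=> [[sA So Do]|[[s1 s2] /setXP[/= s1S s2A] ->]].
  have Ss : stable S s by case/imsetP: So => x _ ->; apply: porbit_stable.
  have Ds : stable (A :\: S) s by case/imsetP: Do => x _ ->; apply: porbit_stable.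
  exists (restr_perm S s, restr_perm (A :\: S) s).
    by rewrite inE /= -!mem_restr // So.
  apply/permP=> x; have [xS|xS] := boolP (x \in S).
    by rewrite fE1 ?restr_perm_on // restr_stableE.
  rewrite fE2 ?restr_perm_on //; have [xA|xA] := boolP (x \in A :\: S).
    by rewrite restr_stableE.
  by rewrite restr_out // (out_perm sA) // EA negb_or xS.
have [s1o _] := setIdP s1S; have [s2o _] := setIdP s2A.
have fS := fstab _ _ s1o s2o; have fA := fon _ _ s1o s2o.
split=> //; first by rewrite mem_restr // fr1.
by rewrite mem_restr // ?fr2 // stableD // perm_on_stable.
Qed.

Lemma porbitJ s t x : porbit (s ^ t)%g (t x) = t @: porbit s x.
Proof.
have E i : ((s ^ t) ^+ i)%g (t x) = t ((s ^+ i)%g x) by rewrite -conjXg permJ.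
apply/setP=> y; apply/porbitP/imsetP=> [[i ->]|[z /porbitP[i ->] ->]].
  by exists ((s ^+ i)%g x); rewrite ?mem_porbit.
by exists i.
Qed.

Lemma full_cyclesJ A s t : perm_on A t -> s \in full_cycles A -> (s ^ t)%g \in full_cycles A.
Proof.
move=> tA /setIdP[sA Ao]; rewrite inE !perm_onM ?perm_onV //=.
case/imsetP: Ao => x _ E; apply/imsetP; exists (t x) => //.
by rewrite porbitJ -E im_perm_on.
Qed.

(** The number [N]. In [D * c] the permutation [D] acts first; when [D] moves only points of [A],
    this composite is a full cycle together with its conjugate [c * D]. *)
Definition num_full A (D : {perm T}) := #|[set c in full_cycles A | A \in porbits (D * c)%g]|.

End CyclesInSet.

(** * First returns and reembeddings *)

Section FirstReturnCycles.
Variable T : finType.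
Implicit Types (g t : {perm T}) (A : {set T}) (x y : T).

Lemma first_return_on g A : perm_on A (first_return_perm g A).
Proof.
by apply/subsetP=> x; rewrite inE permE; apply: contraR => xA; rewrite first_return_out.
Qed.

(* The first return to A of t followed by g is t followed by that of g. *)
Lemma first_return_mul g t A x : perm_on A t -> x \in A ->
  exists j, [/\ 0 < j, (t * first_return_perm g A)%g x = ((t * g) ^+ j)%g x
    & forall i, 0 < i -> ((t * g) ^+ i)%g x \in A -> j <= i].
Proof.
move=> tA xA; have txA : t x \in A by rewrite perm_closed.
have [j [j0 Ej _ jmin]] := first_return_in g txA.
have E i : 0 < i -> i <= j -> ((t * g) ^+ i)%g x = (g ^+ i)%g (t x).
  elim: i => // i IHi _ lt_ij; have [->|i0] := posnP i; first by rewrite !expg1 permM.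
  rewrite !expgSr permM IHi // 1?ltnW // !permM (out_perm tA) //.
  by apply/negP=> /(jmin _ i0); rewrite leqNgt lt_ij.
exists j; split=> //; first by rewrite permM permE Ej E.
move=> i i0 iA; rewrite leqNgt; apply/negP=> lt_ij; have := jmin _ i0.
by rewrite -(E _ i0 (ltnW lt_ij)) => /(_ iA); rewrite leqNgt lt_ij.
Qed.

Lemma single_cycleE g x : single_cycle g = [forall y, y \in porbit g x].
Proof.
apply/cards1P/forallP=> [[C EC] y|xg].
  have mem z : porbit g z = C by apply/set1P; rewrite -EC imset_f.
  by rewrite mem -(mem y) porbit_id.
exists (porbit g x); apply/setP=> C; rewrite inE; apply/imsetP/eqP=> [[y _ ->]|->].
  by apply/eqP; rewrite eq_porbit_mem.
by exists x.
Qed.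

(** As [t] moves only points of [A], an orbit of [t * g] follows [g] outside [A], and its successive
    visits to [A] form an orbit of [t * first_return_perm g A]. Since [g] is a single cycle, every
    point outside [A] reaches [A]. *)
Lemma single_cycle_first_return g t A : A != set0 -> single_cycle g -> perm_on A t ->
  single_cycle (t * g)%g = (A \in porbits (t * first_return_perm g A)%g).
Proof.
move=> /set0Pn[x xA] g1 tA; set h := (t * first_return_perm g A)%g.
have hA : perm_on A h by rewrite perm_onM ?first_return_on.
have hs := perm_on_stable hA.
rewrite (single_cycleE _ x); apply/forallP/idP=> [tg1|Ao y].
  suff -> : A = porbit h x by rewrite imset_f.
  apply/eqP; rewrite eqEsubset stable_porbit_sub // xA andbT; apply/subsetP=> y yA.
  (* Strong induction on the number [k] of steps from [x] to [y]: the first return takes [j <= k] of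
     them, and [k - j] remain. *)
  have /porbitP[k Ek] := tg1 y; move: Ek; have [n] := ubnP k.
  elim: n k x xA {tg1} => // n IHn k x xA lt_kn Ek.
  have [k0|k0] := posnP k; first by rewrite Ek k0 expg0 perm1 porbit_id.
  have [j [j0 Ej jmin]] := first_return_mul g tA xA.
  have le_jk : j <= k by apply: jmin; rewrite // -Ek.
  have := IHn (k - j) (h x); rewrite (stableP _ _ hs) xA Ej -permM -expgD subnKC //.
  rewrite -Ej -eq_porbit_mem -[h x]/((h ^+ 1)%g x) porbit_perm eq_porbit_mem; apply => //.
  by move: j0 le_jk lt_kn; clear; lia.
have memA z : z \in A -> z \in porbit (t * g)%g x.
  rewrite {1}(porbit_in_porbits Ao xA) => /porbitP[k ->].
  have kA i : (h ^+ i)%g x \in A.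
    by rewrite (porbit_in_porbits Ao xA) mem_porbit.
  elim: k => [|k IHk]; first by rewrite expg0 perm1 porbit_id.
  rewrite expgSr permM; have [j [_ -> _]] := first_return_mul g tA (kA k).
  by rewrite -eq_porbit_mem porbit_perm eq_porbit_mem.
have : exists i, (g ^+ i)%g y \in A.
  move: g1; rewrite (single_cycleE _ y) => /forallP/(_ x)/porbitP[i Ei].
  by exists i; rewrite -Ei.
case/ex_minnP=> i iA imin.
have E l : l <= i -> ((t * g) ^+ l)%g y = (g ^+ l)%g y.
  elim: l => [|l IHl] lt_li; first by rewrite !expg0.
  rewrite !expgSr permM IHl 1?ltnW // !permM (out_perm tA) //.
  by apply/negP=> /imin; rewrite leqNgt lt_li.
by rewrite -eq_porbit_mem -(porbit_perm _ i) E // eq_porbit_mem memA.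
Qed.

Lemma odd_full_cycle A t : A != set0 -> t \in full_cycles A -> odd_perm t = ~~ odd #|A|.
Proof.
move=> A0 /setIdP[tA Ao]; have ts := perm_on_stable tA.
rewrite -(restr_perm_on_id tA) -/(restr_odd A t) odd_restr //.
by move: Ao; rewrite mem_porbits_num // => /eqP->; rewrite addbT.
Qed.

End FirstReturnCycles.

Section Reembeddings.
Variables (m : nat) (e : cmap m) (nu : {set 'I_(2 * m)}).
Hypotheses (e1 : one_face e) (nu_vertex : nu \in porbits (vertex_perm e)).

Lemma vertex_neq0 : nu != set0.
Proof.
by case/imsetP: nu_vertex => x _ ->; apply/set0Pn; exists x; apply: porbit_id.
Qed.

Lemma vertex_stable : stable nu (vertex_perm e).
Proof. by case/imsetP: nu_vertex => x _ ->; apply: porbit_stable. Qed.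

Lemma full_cycles_restr s : stable nu s -> nu \in porbits s ->
  restr_perm nu s \in full_cycles nu.
Proof.
move=> ss so; rewrite inE restr_perm_on mem_porbits_num ?vertex_neq0 //.
  by rewrite num_porbits_restr // -mem_porbits_num ?vertex_neq0.
exact/perm_on_stable/restr_perm_on.
Qed.

Lemma local_face_full_cycle : local_face e nu \in full_cycles nu.
Proof.
rewrite inE first_return_on -[local_face e nu]mul1g.
by rewrite -single_cycle_first_return ?mul1g ?perm_on1 ?vertex_neq0.
Qed.

(** The local vertex and local face permutations are full cycles of the same set, hence of equal
    sign. *)
Lemma diagonal_even : ~~ odd_perm (diagonal e nu).
Proof.
rewrite odd_permM odd_permV !(odd_full_cycle vertex_neq0) ?addbb //.
  exact: local_face_full_cycle.
by rewrite full_cycles_restr ?vertex_stable.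
Qed.

(** A reembedding is [c * r] with [c] a full cycle of [nu], where [r] is the identity on [nu] and
    agrees with [beta] elsewhere. Its face permutation is [c * p^-1 * face_perm e]; the visits of
    this to [nu] follow [c * p^-1] and then the local face permutation, that is
    [c * diagonal e nu]. *)
Lemma card_reembeddings :
  #|[set b | reembedding e nu b && single_cycle (b * edge_perm e)%g]|
  = num_full nu (diagonal e nu).
Proof.
have vs := vertex_stable; have nu0 := vertex_neq0.
set beta := vertex_perm e; set p := restr_perm nu beta.
have pnu : perm_on nu p := restr_perm_on _ _.
pose r := (p^-1 * beta)%g.
have r_in x : x \in nu -> r x = x.
  move=> xnu; rewrite permM; have pxnu : (p^-1)%g x \in nu by rewrite perm_closed ?perm_onV.
  by rewrite -[beta _](restr_stableE vs pxnu) permKV.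
have r_out x : x \notin nu -> r x = beta x.
  by move=> xnu; rewrite permM (out_perm (perm_onV pnu)).
rewrite -(card_preimset _ (mulIg r)); apply: eq_card => c; rewrite !inE.
rewrite /reembedding -/beta.
have -> : [forall x, (x \notin nu) ==> ((c * r)%g x == beta x)] = perm_on nu c.
  apply/forallP/idP=> [cr|cnu x]; last first.
    by apply/implyP=> xnu; rewrite permM (out_perm cnu) // r_out.
  apply/subsetP=> x; rewrite inE; apply: contraR => xnu; move: (cr x).
  by rewrite xnu permM -(r_out _ xnu) (inj_eq perm_inj).
case cnu: (perm_on nu c) => //=.
have crs : stable nu (c * r)%g.
  by apply: stable_sub => x xnu; rewrite permM r_in perm_closed.
have -> : (nu \in porbits (c * r)%g) = (nu \in porbits c).
  have cs := perm_on_stable cnu.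
  rewrite (mem_porbits_num nu0 crs) (mem_porbits_num nu0 cs).
  rewrite -(num_porbits_restr crs) -(num_porbits_restr cs).
  congr (num_porbits_in _ _ == _); apply: eq_restr => // x xnu.
  by rewrite permM r_in // perm_closed.
case co: (nu \in porbits c) => //=.
have -> : (c * r * edge_perm e = (c * p^-1) * face_perm e)%g.
  by rewrite face_permE !mulgA.
rewrite (single_cycle_first_return nu0) // ?perm_onM ?perm_onV //.
have -> : (c * p^-1 * first_return_perm (face_perm e) nu = c * diagonal e nu)%g by rewrite mulgA.
have dnu : perm_on nu (diagonal e nu) := diagonal_on e nu.
have conj s t : perm_on nu s -> perm_on nu t -> nu \in porbits (s * t)%g -> nu \in porbits (t * s)%g.
  move=> snu tnu o; have : (s * t)%g \in full_cycles nu by rewrite inE perm_onM.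
  by move/(full_cyclesJ snu); rewrite conjgE !mulgA mulVg mul1g inE => /andP[].
by apply/idP/idP; apply: conj.
Qed.

End Reembeddings.

Local Open Scope ring_scope.

(** * Counting the full cycles *)

Lemma sum_sign_reversing (I : finType) (P : pred I) (F : I -> int) (h : I -> I) :
  involutive h -> (forall i, P (h i) = P i) -> (forall i, P i -> F (h i) = - F i) ->
  \sum_(i | P i) F i = 0.
Proof.
move=> hK hP hF; set s := (X in X = _).
suff: s = - s by lia.
rewrite {1}/s (reindex_inj (can_inj hK)) (eq_bigl _ _ hP) -sumrN.
exact: eq_bigr.
Qed.

Section Indicator.
Variable T : finType.
Implicit Types (s t c : {perm T}) (A S C : {set T}) (x y : T).

Lemma num_porbits_setU_porbit S s y : stable S s -> y \notin S ->
  num_porbits_in (S :|: porbit s y) s = (num_porbits_in S s).+1.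
Proof.
move=> Ss yS; have Cs := porbit_stable s y.
have SC : [disjoint S & porbit s y].
  rewrite disjoint_subset; apply/subsetP=> z zS; rewrite inE; apply: contra yS => zy.
  have := stable_porbit_sub z Ss; rewrite zS => /subsetP; apply.
  by rewrite porbit_sym.
rewrite (num_porbits_disjointU (S := S)) ?subsetUl //; last first.
  by apply/stableP=> z; rewrite !inE (stableP _ _ Ss) (stableP _ _ Cs).
rewrite setDUl setDv set0U.
have -> : porbit s y :\: S = porbit s y by apply/setDidPl; rewrite disjoint_sym.
rewrite -addn1; congr (_ + _)%N; apply/eqP; rewrite -mem_porbits_num ?imset_f //.
by apply/set0Pn; exists y; apply: porbit_id.
Qed.

(** If [A] is not a cycle of [s], some cycle [C] inside [A] avoids [x], and adding [C] to [S] or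
    removing it reverses the sign. If [A] is a cycle, the empty set is the only stable subset of [A]
    avoiding [x]. *)
Lemma sum_stable_avoiding A s x : perm_on A s -> x \in A ->
  \sum_(S : {set T} | [&& S \subset A, stable S s & x \notin S]) (-1) ^+ num_porbits_in S s
  = (A \in porbits s)%:R :> int.
Proof.
move=> As xA; have [Ao|An] := boolP (A \in porbits s).
  rewrite (bigD1 set0) /=; last first.
    by rewrite sub0set inE andbT; apply/stableP=> z; rewrite !inE.
  rewrite num_porbits_in0 big1 ?addr0 // => S /andP[/and3P[SA Ss xS] /set0Pn[y yS]].
  case/negP: xS; have := stable_porbit_sub y Ss; rewrite yS => /subsetP; apply.
  by rewrite -(porbit_in_porbits Ao (subsetP SA y yS)).
have [y /setDP[yA yx]] : exists y, y \in A :\: porbit s x.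
  apply/set0Pn; rewrite setD_eq0; apply: contra An => Ax.
  suff -> : A = porbit s x by rewrite imset_f.
  by apply/eqP; rewrite eqEsubset Ax stable_porbit_sub ?perm_on_stable.
set C := porbit s y; have Cs : stable C s := porbit_stable s y.
have CA : C \subset A by rewrite stable_porbit_sub ?perm_on_stable.
have xC : x \notin C by rewrite porbit_sym.
pose h S := (S :\: C) :|: (C :\: S).
have hK : involutive h.
  by move=> S; apply/setP=> z; rewrite !inE; case: (z \in S); case: (z \in C).
have hs S : stable S s -> stable (h S) s.
  move=> /stableP Ss; apply/stableP=> z.
  by rewrite !inE Ss (stableP _ _ Cs).
apply: (sum_sign_reversing hK) => [S|S /and3P[SA Ss xS]].
  congr [&& _, _ & _].
  - rewrite /h subUset (subset_trans (subsetDl _ _) CA) andbT.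
    apply/idP/idP => [SA|SA]; last exact: subset_trans (subsetDl _ _) SA.
    by rewrite -(setID S C) subUset (subset_trans (subsetIr _ _) CA).
  - by apply/idP/idP=> [/hs|/hs //]; rewrite hK.
  - by rewrite !inE (negPf xC) andbF orbF.
have [yS|yS] := boolP (y \in S).
  have hy : y \notin h S by rewrite !inE yS porbit_id.
  have -> : num_porbits_in S s = (num_porbits_in (h S) s).+1.
    rewrite -(num_porbits_setU_porbit (hs _ Ss) hy); congr (num_porbits_in _ _).
    have CS : C \subset S by rewrite stable_porbit_sub.
    apply/setP=> z; rewrite !inE; have := subsetP CS z.
    by case: (z \in C); case: (z \in S) => // /(_ isT).
  by rewrite exprS mulN1r opprK.
have -> : h S = S :|: porbit s y.
  apply/setP=> z; rewrite !inE -/C; case zC: (z \in C); last by rewrite andbF orbF.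
  rewrite orbT /= andbT; apply/negP => zS; case/negP: yS.
  have := stable_porbit_sub z Ss; rewrite zS => /subsetP; apply.
  by rewrite porbit_sym.
by rewrite num_porbits_setU_porbit // exprS mulN1r.
Qed.

(* Inclusion-exclusion on the cycles avoiding a point, summed over the points. *)
Lemma sum_stable_weighted A s : perm_on A s ->
  \sum_(S : {set T} | (S \subset A) && stable S s)
     (#|A| - #|S|)%:R * (-1) ^+ num_porbits_in S s
  = (#|A| * (A \in porbits s))%:R :> int.
Proof.
move=> As; transitivity (\sum_(x in A) (A \in porbits s)%:R : int); last first.
  by rewrite sumr_const natrM mulr_natl.
rewrite -(eq_bigr _ (fun x => sum_stable_avoiding As (x := x))).
under eq_bigr => x _ do under eq_bigl => S do rewrite andbA andbC.
rewrite (exchange_big_dep (fun S : {set T} => (S \subset A) && stable S s)) /=; last first.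
  by move=> x S _ /andP[].
apply: eq_bigr => S /andP[SA Ss].
under eq_bigl => x do rewrite SA Ss /= andbT andbC -in_setD.
by rewrite sumr_const mulr_natl cardsD (setIidPr SA).
Qed.

(** The sum over [c] that belongs to [S] once the two summations are exchanged. Stability of [S]
    under [D * c] means that [c] carries [D @: S] onto [S]. *)
Definition transport A D S : int :=
  \sum_(c in full_cycles A | stable S (D * c)%g) (-1) ^+ num_porbits_in S (D * c)%g.

Lemma num_full_transport A D : perm_on A D ->
  (#|A| * num_full A D)%:R =
  \sum_(S : {set T} | S \subset A) (#|A| - #|S|)%:R * transport A D S.
Proof.
move=> AD; transitivity (\sum_(c in full_cycles A) (#|A| * (A \in porbits (D * c)%g))%:R : int).
  rewrite -natr_sum -big_distrr /=; congr (_ * _)%:R.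
  rewrite /num_full -sum1_card big_mkcond [RHS]big_mkcond.
  by apply: eq_bigr => c _; rewrite in_set; case: (c \in _); case: (A \in _).
rewrite (eq_bigr (fun c => \sum_(S : {set T} | (S \subset A) && stable S (D * c)%g)
     (#|A| - #|S|)%:R * (-1) ^+ num_porbits_in S (D * c)%g)); last first.
  by move=> c /setIdP[cA _]; rewrite sum_stable_weighted // perm_onM.
rewrite (exchange_big_dep (fun S : {set T} => S \subset A)) /=; last by move=> c S _ /andP[].
apply: eq_bigr => S SA; rewrite mulr_sumr.
by apply: eq_bigl => c; rewrite SA.
Qed.

(* D @: S = (S \ a) U b: the set S is made of cycles of D and of one proper arc
   of another cycle, which starts at a and is followed by b. *)
Definition arc (D : {perm T}) S a b := (S :\: D @: S == [set a]) && (D @: S :\: S == [set b]).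

(** At most one pair [a], [b] occurs. Multiplying by [tperm a b] closes the arc to a cycle, sending
    the point that [D] maps to [b] back to [a]; the term is the sign of the result on [S]. *)
Definition arc_sum D S : int :=
  \sum_a \sum_(b | arc D S a b) (-1) ^+ restr_odd S (D * tperm a b)%g.

End Indicator.

Section Transport.
Variable T : finType.
Implicit Types (s t c D : {perm T}) (A S C : {set T}) (x y a b : T).

Lemma sign_num_porbits S s : stable S s ->
  (-1) ^+ num_porbits_in S s = (-1) ^+ #|S| * (-1) ^+ restr_odd S s :> int.
Proof.
move=> Ss; rewrite -signr_odd -[in RHS]signr_odd odd_restr // -signr_addb.
by rewrite addbA addbb.
Qed.

Lemma card_setDC (S S' : {set T}) : #|S| = #|S'| -> #|S :\: S'| = #|S' :\: S|.
Proof. by move=> E; rewrite !cardsD setIC E. Qed.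

Lemma arc_sumE D S a b : S :\: D @: S = [set a] -> D @: S :\: S = [set b] ->
  arc_sum D S = (-1) ^+ restr_odd S (D * tperm a b)%g.
Proof.
move=> Ea Eb; rewrite /arc_sum (bigD1 a) //= (bigD1 b) /=; last by rewrite /arc Ea Eb !eqxx.
rewrite big1 ?addr0 => [|b' /andP[/andP[_]]]; last first.
  by rewrite Eb => /eqP/set1_inj->; rewrite eqxx.
rewrite big1 ?addr0 // => a' aa'; rewrite big1 // => b' /andP[].
by rewrite Ea => /eqP/set1_inj Ea'; rewrite Ea' eqxx in aa'.
Qed.

Lemma arc_sum0 D S : #|S :\: D @: S| != 1%N -> arc_sum D S = 0.
Proof.
move=> S1; rewrite /arc_sum big1 // => a _; rewrite big1 // => b /andP[/eqP E].
by rewrite E cards1 in S1.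
Qed.

Lemma transport0 A D : A != set0 -> transport A D set0 = (#|A|.-1)`!%:R.
Proof.
move=> A0; rewrite /transport.
under eq_bigr => c _ do rewrite num_porbits_in0.
rewrite sumr_const -card_full_cycles //; congr (_ *+ _); apply: eq_card => c.
rewrite unfold_in /= andbC; suff -> : stable set0 (D * c)%g by [].
by apply: stable_sub => x; rewrite inE.
Qed.

(* If S \ D(S) contains two points, conjugating c by their transposition is a
   sign-reversing involution. If S \ D(S) = {a} and D(S) \ S = {b}, multiplying c
   by the transposition of a and b splits it into a cycle on S and one on A \ S. *)
Lemma transport_arc A D S : perm_on A D -> S \proper A -> S != set0 ->
  transport A D S = - ((#|S|.-1)`! * (#|A :\: S|.-1)`!)%:R * arc_sum D S.
Proof.
move=> AD /properP[SA [z zA zS]] S0.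
have D0 : A :\: S != set0 by apply/set0Pn; exists z; rewrite inE zS.
have cardS : #|D @: S| = #|S| by rewrite card_imset //; apply: perm_inj.
(* If [D @: S] equals [S], then [c] would preserve the proper nonempty subset [S] of its single
   cycle, so the sum is empty. *)
have [E0|] := eqVneq (S :\: D @: S) set0.
  rewrite arc_sum0 ?E0 ?cards0 // mulr0 /transport big_pred0 // => c.
  apply/negP=> /andP[/setIdP[cA Ao] SDc].
  have SD : stable S D.
    by rewrite /stable eq_sym eqEcard cardS leqnn andbT -setD_eq0 E0.
  have Sc : stable S c by rewrite -[c](mulKg D) stableM // stableV.
  have A0 : A != set0 by apply/set0Pn; exists z.
  move: Ao; rewrite mem_porbits_num ?perm_on_stable //.
  have cAs := perm_on_stable cA.
  rewrite (num_porbits_disjointU cAs Sc SA); case/set0Pn: S0 => y yS.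
  have := num_porbits_in_gt0 Sc yS.
  have := @num_porbits_in_gt0 _ (A :\: S) c z; rewrite stableD // inE zS zA => /(_ isT isT).
  by case: (num_porbits_in S c) => [|[|i]]; case: (num_porbits_in (A :\: S) c).
rewrite -card_gt0 leq_eqVlt => /orP[/eqP/esym/eqP S1|/card_gt1P[a1 [a2 [a1S a2S a12]]]]; last first.
  rewrite arc_sum0; last first.
    by rewrite neq_ltn orbC; apply/orP; left; apply/card_gt1P; exists a1, a2.
  rewrite mulr0; set t := tperm a1 a2.
  have [[a1S' a1D] [a2S' a2D]] := (setDP a1S, setDP a2S).
  have tS : perm_on S t.
    by apply: subset_trans (tperm_on _ _) _; apply/subsetP=> x; rewrite !inE => /orP[]/eqP->.
  have tA : perm_on A t := subset_trans tS SA.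
  (* Neither [a1] nor [a2] lies in [D @: S], so on [S] conjugating [c] by [t] has the effect of
     multiplying [D * c] by [t]. *)
  have hE c x : x \in S -> (D * (c ^ t))%g x = (D * c * t)%g x.
    move=> xS; rewrite !permM tpermV; congr (t (c _)); apply: tpermD.
      by apply: contraNneq a1D => ->; rewrite imset_f.
    by apply: contraNneq a2D => ->; rewrite imset_f.
  have hst c : stable S (D * c)%g -> stable S (D * (c ^ t))%g.
    move=> /stableP Sc; apply: stable_sub => x xS.
    by rewrite hE // permM perm_closed // Sc.
  have hK : involutive (fun c : {perm T} => c ^ t)%g.
    by move=> c; rewrite -conjgM tperm2 conjg1.
  apply: (sum_sign_reversing hK) => c.
    apply/andP/andP => -[cA /hst cS]; have {}cA := full_cyclesJ tA cA.
      by rewrite hK in cA cS.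
    by [].
  move=> /andP[cA cS]; rewrite !sign_num_porbits ?hst //.
  have -> : restr_odd S (D * c ^ t)%g = ~~ restr_odd S (D * c)%g.
    have Stab := stableM cS (perm_on_stable tS).
    transitivity (restr_odd S (D * c * t)%g); first by rewrite /restr_odd (eq_restr Stab (hE c)).
    rewrite (restr_oddM cS (perm_on_stable tS)) [restr_odd S t]/restr_odd.
    by rewrite (restr_perm_on_id tS) odd_tperm a12 addbT.
  by rewrite signrN mulrN.
have [a Ea] := cards1P S1.
have [b Eb] : exists b, D @: S :\: S = [set b] by apply/cards1P; rewrite -card_setDC.
have /setDP[aS aD] : a \in S :\: D @: S by rewrite Ea inE.
have /setDP[bD bS] : b \in D @: S :\: S by rewrite Eb inE.
have ab : a != b by apply: contraNneq bS => <-.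
have bA : b \in A by case/imsetP: bD => x xS ->; rewrite perm_closed // (subsetP SA).
set t := tperm a b.
have tA : perm_on A t.
  by apply: subset_trans (tperm_on _ _) _; apply/subsetP=> x; rewrite !inE => /orP[]/eqP-> //; apply: (subsetP SA).
have StD : stable S (D * t)%g.
  apply: stable_sub => x xS; rewrite permM /t; case: tpermP => [Ex|_ //|_ xb].
    by case/negP: aD; rewrite -Ex imset_f.
  have [//|DxS] := boolP (D x \in S); case: xb; apply/set1P.
  by rewrite -Eb inE DxS imset_f.
have DcE c : (D * c = (D * t) * (t * c))%g by rewrite -mulgA tpermKg.
(* For the [c] of the sum, [t * c] has the cycles [S] and [A :\: S]: as [a] lies in [S] and [b] does
   not, [t] joins these two to the full cycle [c]. *)
pose two := [set s : {perm T} | [&& perm_on A s, S \in porbits s & A :\: S \in porbits s]].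
have mem_two c : (c \in full_cycles A) && stable S (D * c)%g = ((t * c)%g \in two).
  rewrite !inE; have -> : perm_on A (t * c)%g = perm_on A c.
    by apply/idP/idP=> cA; [rewrite -[c](tpermKg a b) |]; apply: perm_onM.
  case cA: (perm_on A c) => //=.
  have tcA : perm_on A (t * c)%g by apply: perm_onM.
  have -> : stable S (D * c)%g = stable S (t * c)%g.
    rewrite DcE; apply/idP/idP=> Sc; last exact: stableM.
    by rewrite -[(t * c)%g](mulKg (D * t)%g) stableM // stableV.
  case Sc: (stable S (t * c)%g); last first.
    rewrite andbF; apply/esym/andP=> -[So _]; case/negP: (negbT Sc).
    by case/imsetP: So => x _ ->; apply: porbit_stable.
  have A0 : A != set0 by apply/set0Pn; exists z.
  have tcs := perm_on_stable tcA.
  rewrite andbT !mem_porbits_num ?(stableD tcs) //; last exact: perm_on_stable.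
  have := num_porbits_tperm tcA (subsetP SA _ aS) bA ab; rewrite tpermKg.
  have -> : a \notin porbit (t * c)%g b.
    apply: contra bS => ab'; have := stable_porbit_sub a Sc; rewrite aS => /subsetP; apply.
    by rewrite porbit_sym.
  rewrite (num_porbits_disjointU tcs Sc SA).
  have := num_porbits_in_gt0 Sc aS.
  have := @num_porbits_in_gt0 _ (A :\: S) (t * c)%g z; rewrite stableD // inE zS zA => /(_ isT isT).
  case: (num_porbits_in S _) => [|[|i]]; case: (num_porbits_in (A :\: S) _) => [|[|j]] // _ _;
    by rewrite addn2 ?addSn ?addnS ?add0n ?addn0 => -[->].
rewrite /transport (eq_bigl _ _ mem_two) (arc_sumE Ea Eb) -card_two_cycles //.
rewrite (eq_bigr (fun _ => - (-1) ^+ restr_odd S (D * t)%g)) => [|c].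
  rewrite sumr_const -[LHS]mulr_natl mulrN mulNr -(card_preimset two (mulgI t)).
  by congr (- (_%:R * _)); apply: eq_card => c; rewrite inE.
rewrite inE => /and3P[_ So _].
have Sc : stable S (t * c)%g by case/imsetP: So => x _ ->; apply: porbit_stable.
(* Split [D * c] as [(D * t) * (t * c)]. On [S] the second factor is one cycle, of sign
   [(-1)^(#|S| - 1)]; together with the factor [(-1)^#|S|] of [sign_num_porbits] this leaves
   [-1]. *)
rewrite (DcE c) (sign_num_porbits (stableM StD Sc)) (restr_oddM StD Sc) (odd_restr Sc).
have -> : num_porbits_in S (t * c)%g = 1%N by apply/eqP; rewrite -mem_porbits_num.
rewrite -[_ ^+ #|S|]signr_odd -signr_addb; case: (odd #|S|); by case: (restr_odd _ _).
Qed.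

End Transport.

(** * Extensions of [D] by one point *)

Section Arcs.
Variable T : finType.
Variable D : {perm T}.
Implicit Types (A S U : {set T}) (x y a b : T).

Definition stable_sign S : int := if stable S D then (-1) ^+ restr_odd S D else 0.

(* The permutation D, restricted to U \ x with values in U, extends in a unique
   way to a permutation of U, which maps x to the missing value a. *)
Definition extension_sign U x : int :=
  if D @: (U :\ x) \subset U then
    \sum_(a in U :\: D @: (U :\ x)) (-1) ^+ restr_odd U (D * tperm (D x) a)%g
  else 0.

Lemma imsetD1_perm U x : D @: (U :\ x) = D @: U :\ D x.
Proof.
apply/setP=> y; rewrite !inE; apply/imsetP/andP => [[z /setD1P[zx zU] ->]|[yx /imsetP[z zU Ey]]].
  by rewrite (inj_eq perm_inj) imset_f.
by exists z; rewrite // !inE zU andbT; apply: contraNneq yx => <-; rewrite Ey.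
Qed.

Lemma card_imset_perm S : #|D @: S| = #|S|.
Proof. by rewrite card_imset //; apply: perm_inj. Qed.

Lemma stableE S : stable S D = (S :\: D @: S == set0).
Proof. by rewrite setD_eq0 /stable eq_sym eqEcard card_imset_perm leqnn andbT. Qed.

Lemma arc_setP S : reflect (exists a b, S :\: D @: S = [set a] /\ D @: S :\: S = [set b])
  (#|S :\: D @: S| == 1%N).
Proof.
apply: (iffP cards1P) => [[a Ea]|[a [b [Ea _]]]]; last by exists a.
have /cards1P[b Eb] : #|D @: S :\: S| == 1%N.
  by rewrite -(@card_setDC _ S) ?Ea ?cards1 // card_imset_perm.
by exists a, b.
Qed.

Lemma arc_stable S a b : S :\: D @: S = [set a] -> D @: S :\: S = [set b] ->
  stable S (D * tperm a b)%g.
Proof.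
move=> Ea Eb.
have /setDP[aS aD] : a \in S :\: D @: S by rewrite Ea inE.
have /setDP[bD bS] : b \in D @: S :\: S by rewrite Eb inE.
apply: stable_sub => x xS; rewrite permM; case: tpermP => [Ex|_ //|_ xb].
  by case/negP: aD; rewrite -Ex imset_f.
have [//|DxS] := boolP (D x \in S); case: xb; apply/set1P.
by rewrite -Eb inE DxS imset_f.
Qed.

Lemma arc_sum_stable S : stable S D -> arc_sum D S = 0.
Proof. by rewrite stableE => /eqP SD; rewrite arc_sum0 // SD cards0. Qed.

Lemma extension_sign0 U x : #|U :\: D @: U| != 1%N -> ~~ stable U D ->
  extension_sign U x = 0.
Proof.
move=> U1 Us; rewrite /extension_sign; case: ifP => // sub.
have DU : D @: U :\: U \subset [set D x].
  apply/subsetP=> y /setDP[yD yU]; rewrite inE; apply: contraR yU => yx.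
  by apply: (subsetP sub); rewrite imsetD1_perm !inE yx.
have := subset_leq_card DU; rewrite cards1 -(@card_setDC _ U) ?card_imset_perm //.
by rewrite leq_eqVlt (negPf U1) ltnS leqn0 cards_eq0 -stableE (negPf Us).
Qed.

(** If [U] is stable, every [x] in [U] qualifies and the extension is [D] itself. If [U] consists of
    cycles and one arc, only the last point of the arc qualifies, and the extension closes the
    arc. *)
Lemma sum_extension_sign_mem U :
  \sum_(x in U) extension_sign U x = #|U|%:R * stable_sign U + arc_sum D U.
Proof.
rewrite /stable_sign; have [Us|Us] := boolP (stable U D).
  rewrite arc_sum_stable // addr0 mulr_natl -sumr_const; apply: eq_bigr => x xU.
  rewrite /extension_sign imsetD1_perm (eqP Us) subsetDl.
  have -> : U :\: (U :\ D x) = [set D x].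
    apply/setP=> y; rewrite !inE; have [->|_] := eqVneq y (D x); last by rewrite andNb.
    by rewrite (stableP _ _ Us).
  by rewrite big_set1 tperm1 mulg1.
rewrite mulr0 add0r; have [/arc_setP[a [b [Ea Eb]]]|U1] := boolP (#|U :\: D @: U| == 1%N).
  rewrite (arc_sumE Ea Eb).
  have /setDP[/imsetP[x0 x0U Eb0] bU] : b \in D @: U :\: U by rewrite Eb inE.
  rewrite (bigD1 x0) //= big1 ?addr0 => [|x /andP[xU xx0]]; last first.
    rewrite /extension_sign; case: ifP => // /subsetP/(_ b).
    by rewrite Eb0 imset_f ?inE ?x0U 1?eq_sym ?xx0 // => /(_ isT); rewrite -Eb0 (negPf bU).
  rewrite /extension_sign imsetD1_perm -Eb0; case: ifP => [_|/negP[]]; last first.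
    apply/subsetP=> y /setD1P[yb yD]; apply: contraNT yb => yU.
    by rewrite -in_set1 -Eb inE yU.
  have -> : U :\: (D @: U :\ b) = [set a].
    rewrite -Ea; apply/setP=> y; rewrite !inE; case: eqP => [->|//].
    by rewrite (negPf bU) !andbF.
  by rewrite big_set1 tpermC.
by rewrite arc_sum0 // big1 // => x _; apply: extension_sign0.
Qed.

(** If [S] is stable, every [x] outside it qualifies and becomes a fixed point, which keeps the
    sign. If [S] has one arc, only the point [b] that follows it qualifies; it is inserted into the
    closed arc, and a cycle longer by one has the opposite sign. *)
Lemma sum_extension_sign_notin A S : perm_on A D -> S \subset A ->
  \sum_(x in A :\: S) extension_sign (x |: S) x
  = (#|A| - #|S|)%:R * stable_sign S - arc_sum D S.
Proof.
move=> AD SA; rewrite /stable_sign /extension_sign; have [Ss|Ss] := boolP (stable S D).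
  have <- : #|A :\: S| = (#|A| - #|S|)%N by rewrite cardsD (setIidPr SA).
  rewrite arc_sum_stable // subr0 mulr_natl -sumr_const.
  apply: eq_bigr => x /setDP[xA xS]; rewrite setU1K // (eqP Ss) subsetUr.
  rewrite setDUl setDv setU0 (setDidPl _) ?disjoints1 // big_set1; congr (_ ^+ nat_of_bool (odd_perm _)).
  have DxS : D x \notin S by rewrite (stableP _ _ Ss).
  have Dx s : s \in S -> (D * tperm (D x) x)%g s = D s.
    move=> sS; rewrite permM tpermD //; first by apply: contraNneq DxS => ->; rewrite (stableP _ _ Ss).
    by apply: contraNneq xS => ->; rewrite (stableP _ _ Ss).
  have Ust : stable (x |: S) (D * tperm (D x) x)%g.
    apply: stable_sub => y /setU1P[->|yS]; first by rewrite permM tpermL setU11.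
    by rewrite Dx // !inE (stableP _ _ Ss) yS orbT.
  apply/permP=> y; have [yS|yS] := boolP (y \in S).
    by rewrite !restr_stableE ?Dx // !inE yS orbT.
  rewrite [RHS]restr_out //; have [->|yx] := eqVneq y x.
    by rewrite restr_stableE ?setU11 // permM tpermL.
  by rewrite restr_out // !inE (negPf yx).
rewrite mulr0 add0r; have [/arc_setP[a [b [Ea Eb]]]|S1] := boolP (#|S :\: D @: S| == 1%N); last first.
  rewrite arc_sum0 // oppr0 big1 // => x /setDP[xA xS]; rewrite setU1K //; case: ifP => // sub.
  have DS : D @: S :\: S \subset [set x].
    apply/subsetP=> y /setDP[yD yS]; have := subsetP sub y yD.
    by rewrite !inE (negPf yS) orbF.
  have := subset_leq_card DS; rewrite cards1 -(@card_setDC _ S) ?card_imset_perm //.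
  by rewrite leq_eqVlt (negPf S1) ltnS leqn0 cards_eq0 -stableE (negPf Ss).
rewrite (arc_sumE Ea Eb).
have /setDP[aS aD] : a \in S :\: D @: S by rewrite Ea inE.
have /setDP[bD bS] : b \in D @: S :\: S by rewrite Eb inE.
have ab : a != b by apply: contraNneq bS => <-.
have bA : b \in A by case/imsetP: bD => x xS ->; rewrite perm_closed // (subsetP SA).
rewrite (bigD1 b) /=; last by rewrite inE bS.
rewrite [X in _ + X]big1 ?addr0 => [|x /andP[/setDP[xA xS] xb]]; last first.
  rewrite setU1K //; case: ifP => // /subsetP/(_ b bD).
  by rewrite !inE (negPf bS) orbF eq_sym (negPf xb).
have DSU : D @: S \subset b |: S.
  by apply/subsetP=> y yD; rewrite !inE -in_set1 -Eb inE yD andbT orNb.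
rewrite setU1K // DSU.
have -> : (b |: S) :\: D @: S = [set a].
  rewrite setDUl Ea; have -> : [set b] :\: D @: S = set0 by apply/eqP; rewrite setD_eq0 sub1set.
  by rewrite set0U.
rewrite big_set1 -signrN; congr (_ ^+ nat_of_bool _).
set D' := (D * tperm (D b) a)%g.
have D'S s : s \in S -> D' s = D s.
  move=> sS; rewrite permM tpermD //; last by apply: contraNneq aD => ->; rewrite imset_f.
  by rewrite (inj_eq perm_inj); apply: contraNneq bS => ->.
have D'b : D' b = a by rewrite permM tpermL.
have Ust : stable (b |: S) D'.
  apply: stable_sub => y /setU1P[->|yS]; first by rewrite D'b !inE aS orbT.
  by rewrite D'S // (subsetP DSU) // imset_f.
have Sst := arc_stable Ea Eb.
suff E : restr_perm S (D * tperm a b)%g = (restr_perm (b |: S) D' * tperm a b)%g.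
  by rewrite [in RHS]/restr_odd E odd_permM odd_tperm ab addbT negbK.
apply/permP=> y; rewrite permM; have [yS|yS] := boolP (y \in S).
  by rewrite !restr_stableE ?D'S ?permM // !inE yS orbT.
rewrite restr_out //; have [->|yb] := eqVneq y b.
  by rewrite restr_stableE ?setU11 // D'b tpermL.
rewrite restr_out; last by rewrite !inE negb_or yb.
by rewrite tpermD //; [apply: contraNneq yS => <- | rewrite eq_sym].
Qed.

Lemma sum_extension_sign A (w : nat -> int) :
  \sum_(S : {set T} | S \subset A) w #|S| * \sum_(x in A :\: S) extension_sign (x |: S) x
  = \sum_(U : {set T} | U \subset A) w #|U|.-1 * \sum_(x in U) extension_sign U x.
Proof.
transitivity (\sum_(x in A) \sum_(S : {set T} | (S \subset A) && (x \notin S))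
    w #|S| * extension_sign (x |: S) x).
  rewrite (exchange_big_dep (fun S : {set T} => S \subset A)) /=; last by move=> x S _ /andP[].
  apply: eq_bigr => S SA; rewrite mulr_sumr; apply: eq_bigl => x.
  by rewrite inE SA andbC.
transitivity (\sum_(x in A) \sum_(U : {set T} | (U \subset A) && (x \in U))
    w #|U|.-1 * extension_sign U x); last first.
  rewrite (exchange_big_dep (fun S : {set T} => S \subset A)) /=; last by move=> x S _ /andP[].
  apply: eq_bigr => U UA; rewrite mulr_sumr; apply: eq_bigl => x.
  by rewrite UA /=; case xU: (x \in U); rewrite ?andbF ?(subsetP UA).
apply: eq_bigr => x xA.
rewrite (reindex_onto (fun U => U :\ x) (fun S => x |: S)) /=; last first.
  by move=> S /andP[_ xS]; rewrite setU1K.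
apply: eq_big => [U|U /andP[_ /eqP <-]].
  rewrite !inE eqxx andbT; apply/andP/andP=> [[UA /eqP <-]|[UA xU]].
    by rewrite setU11 subUset sub1set xA.
  by rewrite (subset_trans (subD1set _ _) UA) setD1K.
by rewrite setU1K ?setD11 // cardsU1 setD11.
Qed.

(** With [n = #|A|], the empty set contributes [n!] to [num_full_transport] and the arcs contribute
    [- E]. The double count with weights [i! (n - i)!] then expresses [(n + 1) E] through the stable
    sets. *)
Lemma num_full_formula A : perm_on A D -> A != set0 ->
  (#|A|.+1 * #|A| * num_full A D)%:R =
  \sum_(S : {set T} | S \subset A) (#|S|`! * (#|A| - #|S|)`!)%:R * stable_sign S.
Proof.
move=> AD A0; have n0 : (0 < #|A|)%N by rewrite card_gt0.
rewrite -mulnA natrM num_full_transport //.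
pose E := \sum_(S : {set T} | S \subset A) ((#|S|.-1)`! * (#|A| - #|S|)`!)%:R * arc_sum D S.
have sum0 (x : int) : \sum_(S : {set T} | S \subset A) (S == set0)%:R * x = x.
  rewrite (bigD1 set0) ?sub0set //= eqxx mul1r big1 ?addr0 // => S /andP[_ /negPf->].
  by rewrite mul0r.
have st0 : stable set0 D by apply: stable_sub => x; rewrite inE.
have -> : \sum_(S : {set T} | S \subset A) (#|A| - #|S|)%:R * transport A D S =
    #|A|`!%:R - E.
  rewrite -[X in X - _]sum0 -sumrB; apply: eq_bigr => S SA.
  have [->|S0] := eqVneq S set0.
    rewrite transport0 // arc_sum_stable // mulr0 subr0 mul1r cards0 subn0 -natrM.
    by rewrite -[in RHS](prednK n0) factS prednK.
  have [->|SnA] := eqVneq S A.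
    by rewrite subnn arc_sum_stable ?perm_on_stable // mulr0 !mul0r subr0.
  have SpA : S \proper A by rewrite properEneq SnA.
  rewrite transport_arc // mul0r sub0r cardsD (setIidPr SA) mulrA mulrN mulNr -natrM mulnCA.
  have : (0 < #|A| - #|S|)%N by rewrite subn_gt0 proper_card.
  by case: (#|A| - #|S|)%N => // k _; rewrite factS.
have key : #|A|.+1%:R * E = #|A|.+1%:R * #|A|`!%:R -
  \sum_(S : {set T} | S \subset A) (#|S|`! * (#|A| - #|S|)`!)%:R * stable_sign S.
  have := sum_extension_sign A (fun i => (i`! * (#|A| - i)`!)%:R).
  under eq_bigr => S SA do rewrite sum_extension_sign_notin // mulrBr.
  under [in RHS]eq_bigr => S SA do rewrite sum_extension_sign_mem mulrDr.
  rewrite sumrB big_split /= => /eqP; rewrite subr_eq -addrA addrC -subr_eq -sumrB => /eqP H.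
  rewrite /E mulr_sumr -[X in X - _]sum0 -sumrB.
  (* For an arc of [s] points, [(s - 1)! (n - s + 1)! + s! (n - s)! = (n + 1) (s - 1)! (n - s)!]. *)
  transitivity (\sum_(S : {set T} | S \subset A)
     (((#|S|.-1)`! * (#|A| - #|S|.-1)`!)%:R * arc_sum D S
      + (#|S|`! * (#|A| - #|S|)`!)%:R * arc_sum D S)).
    apply: eq_bigr => S SA; have [->|S0] := eqVneq S set0.
      by rewrite arc_sum_stable // !mulr0 addr0.
    rewrite -mulrDl mulrA -natrM -natrD; congr (_%:R * _).
    have := subset_leq_card SA; have : (0 < #|S|)%N by rewrite card_gt0.
    case: #|S| => // j _ jn; rewrite -pred_Sn (_ : #|A| - j = (#|A| - j.+1).+1)%N; last lia.
    rewrite !factS; set k := (#|A| - j.+1)%N; have -> : #|A| = (j.+1 + k)%N by lia.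
    ring.
  rewrite big_split /= -H; apply: eq_bigr => S SA.
  have [->|S0] := eqVneq S set0.
    rewrite cards0 mul0r mulr0 subr0 subn0 /stable_sign st0 mul1n.
    have -> : restr_odd set0 D = false.
      by rewrite odd_restr // cards0 num_porbits_in0.
    rewrite expr0 !mulr1 mul1r -natr1; ring.
  (* For a stable set of [s > 0] points, [(n - s) s! (n - s)! - s (s - 1)! (n - s + 1)! = - s! (n -
     s)!]. *)
  rewrite mul0r sub0r !mulrA -mulrBl -[RHS]mulNr; congr (_ * _).
  have := subset_leq_card SA; have : (0 < #|S|)%N by rewrite card_gt0.
  case: #|S| => // j _ jn; rewrite -pred_Sn (_ : #|A| - j = (#|A| - j.+1).+1)%N; last lia.
  rewrite !factS; set k := (#|A| - j.+1)%N.
  rewrite !natrM -!natr1; ring.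
by rewrite mulrBr key; ring.
Qed.

End Arcs.

(** * Integrals of cycle polynomials *)

Section PolyIntegral.
Variable R : rcfType.
Implicit Types (p q : {poly R}) (a b : R).

(** The constant coefficient is a quotient by 0, hence 0, so this is the antiderivative that
    vanishes at 0. *)
Definition antideriv p : {poly R} := \poly_(i < (size p).+1) (p`_i.-1 / i%:R).

Lemma coef_antideriv p i : (antideriv p)`_i = p`_i.-1 / i%:R.
Proof.
rewrite coef_poly ltnS; case: leqP => // lt_p_i.
case: i lt_p_i => //= i le_p_i; rewrite nth_default ?mul0r //.
Qed.

Lemma antiderivK p : (antideriv p)^`() = p.
Proof.
apply/polyP=> i; rewrite coef_deriv coef_antideriv -[(_ / _) *+ _]mulr_natr divfK //.
by rewrite pnatr_eq0.
Qed.

Lemma antideriv_deriv p : antideriv p^`() = p - (p`_0)%:P.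
Proof.
apply/polyP=> -[|i]; rewrite coef_antideriv coefB coefC /=.
  by rewrite invr0 mulr0 subrr.
by rewrite coef_deriv subr0 -[p`_i.+1 *+ _]mulr_natr mulfK // pnatr_eq0.
Qed.

Definition integ a b p : R := (antideriv p).[b] - (antideriv p).[a].

Lemma integ_deriv a b p : integ a b p^`() = p.[b] - p.[a].
Proof. by rewrite /integ antideriv_deriv !hornerD !hornerN !hornerC; ring. Qed.

Lemma integD a b p q : integ a b (p + q) = integ a b p + integ a b q.
Proof.
have -> : p + q = (antideriv p + antideriv q)^`() by rewrite derivD !antiderivK.
by rewrite integ_deriv !hornerD /integ; ring.
Qed.

Lemma integZ a b c p : integ a b (c *: p) = c * integ a b p.
Proof.
have -> : c *: p = (c *: antideriv p)^`() by rewrite derivZ antiderivK.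
by rewrite integ_deriv !hornerZ /integ; ring.
Qed.

Lemma integN a b p : integ a b (- p) = - integ a b p.
Proof. by rewrite -scaleN1r integZ mulN1r. Qed.

Lemma integ_sum a b (I : Type) (r : seq I) (P : pred I) (F : I -> {poly R}) :
  integ a b (\sum_(i <- r | P i) F i) = \sum_(i <- r | P i) integ a b (F i).
Proof.
apply: (big_morph (integ a b)); first exact: integD.
by rewrite -(scale0r 0) integZ mul0r.
Qed.

Lemma integ_ge0 a b p : a <= b -> (forall x, a <= x <= b -> 0 <= p.[x]) ->
  0 <= integ a b p.
Proof.
move=> ab p0; rewrite subr_ge0; apply: (@ler_hornerW _ a b) => //.
- move=> x; rewrite in_itv /= antiderivK => /andP[ax xb].
  by apply: p0; rewrite !ltW.
- by rewrite in_itv /= lexx.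
- by rewrite in_itv /= lexx andbT.
Qed.

Lemma le_integ a b p q : a <= b ->
  (forall x, a <= x <= b -> p.[x] <= q.[x]) -> integ a b p <= integ a b q.
Proof.
move=> ab pq; rewrite -subr_ge0 -integN -integD; apply: integ_ge0 => // x xab.
by rewrite hornerD hornerN subr_ge0 pq.
Qed.

Lemma integ_split a b c p : integ a c p = integ a b p + integ b c p.
Proof. by rewrite /integ; ring. Qed.

Lemma integ_reflect a b p :
  integ a b (p \Po (1 - 'X)) = integ (1 - b) (1 - a) p.
Proof.
have -> : p \Po (1 - 'X) = - (antideriv p \Po (1 - 'X))^`().
  by rewrite deriv_comp antiderivK derivB derivX derivC sub0r mulrN1 opprK.
by rewrite integN integ_deriv !horner_comp !hornerE /integ; ring.
Qed.

(** Induction on [i]: [X^(i+1) (1 - X)^(j+1)] vanishes at 0 and 1, so integrating its derivative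
    trades a power of [X] for a power of [1 - X]. *)
Lemma integ_beta i j :
  integ 0 1 ('X^i * (1 - 'X) ^+ j) * (i + j).+1`!%:R = (i`! * j`!)%:R.
Proof.
have dX k : ((1 - 'X) ^+ k.+1)^`() = - k.+1%:R *: (1 - 'X) ^+ k :> {poly R}.
  by rewrite deriv_exp derivB derivX derivC sub0r /= mulN1r -scaler_nat scaleNr scalerN.
elim: i j => [|i IHi] j.
  rewrite expr0 mul1r mul1n add0n.
  have := integ_deriv 0 1 ((1 - 'X) ^+ j.+1); rewrite dX integZ !hornerE.
  rewrite subrr subr0 expr1n expr0n /= sub0r mulNr => /oppr_inj /(congr1 ( *%R^~ j`!%:R)).
  by rewrite mul1r factS natrM [integ _ _ _ * _]mulrC mulrAC.
have := integ_deriv 0 1 ('X^(i.+1) * (1 - 'X) ^+ j.+1).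
rewrite derivM dX derivXn -scaler_nat -scalerAl -scalerAr integD !integZ !hornerE.
rewrite subrr !expr0n /= ?mul0r ?mulr0 subrr mulNr.
move/eqP; rewrite subr_eq0 => /eqP E.
have := IHi j.+1; rewrite !addnS => /(congr1 ( *%R i.+1%:R)).
rewrite addSn mulrA E -mulrA [RHS]mulrC -natrM -mulnA -[(j.+1)`!]/(j.+1 * j`!)%N.
move=> H; apply: (@mulfI _ j.+1%:R); first by rewrite pnatr_eq0.
by rewrite H -natrM; congr (_%:R); rewrite factS; ring.
Qed.

End PolyIntegral.

(** * Bounds for products of cycle polynomials *)

Section CyclePoly.
Variable R : rcfType.
Implicit Types (p : {poly R}) (x : R) (l : nat) (s : seq nat).

Definition cycle_poly l : {poly R} := (1 - 'X) ^+ l - (- 'X) ^+ l.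

Definition type_poly s : {poly R} := \prod_(l <- s) cycle_poly l.

(** The factor 2 makes this the integral over [[0, 1]] when [p] is symmetric under [X -> 1 - X]; on
    [[0, 1/2]] all cycle polynomials are nonnegative. *)
Definition half_integ p : R := 2 * integ 0 2^-1 p.

Lemma horner_cycle_poly l x : (cycle_poly l).[x] = (1 - x) ^+ l - (- x) ^+ l.
Proof. by rewrite !hornerE. Qed.

Lemma deriv_cycle_poly l : (cycle_poly l)^`() = - l%:R *: cycle_poly l.-1.
Proof.
rewrite derivB !deriv_exp derivB derivX derivC sub0r derivN derivX !mulN1r.
by rewrite -mulrnBl scaleNr scaler_nat -mulNrn; congr (_ *+ _); rewrite /cycle_poly; ring.
Qed.

Lemma cycle_poly_ge0 l x : 0 <= x <= 2^-1 -> 0 <= (cycle_poly l).[x].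
Proof.
move=> /andP[x0 x1]; rewrite horner_cycle_poly subr_ge0.
apply: le_trans (ler_norm _) _; rewrite normrX normrN ger0_norm //.
by apply: lerXn2r; rewrite ?nnegrE; lra.
Qed.

Lemma type_poly_ge0 s x : 0 <= x <= 2^-1 -> 0 <= (type_poly s).[x].
Proof.
move=> x01; rewrite /type_poly horner_prod; apply: prodr_ge0 => l _.
exact: cycle_poly_ge0.
Qed.

Lemma type_poly_cons l s : type_poly (l :: s) = cycle_poly l * type_poly s.
Proof. by rewrite /type_poly big_cons. Qed.

Lemma type_poly0 s : all (leq 2) s -> (type_poly s).[0] = 1.
Proof.
elim: s => [|l s IHs] /=; first by rewrite /type_poly big_nil hornerC.
move=> /andP[l2 /IHs s1]; rewrite type_poly_cons hornerM s1 horner_cycle_poly.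
by case: l l2 => // l _; rewrite subr0 expr1n oppr0 expr0n /= subr0 mulr1.
Qed.

(* Integrate the derivative of (1 - 2X) P over [0, 1/2]. *)
Lemma half_integ_parts s : all (leq 2) s ->
  half_integ (type_poly s) = 1 + integ 0 2^-1 ((1 - 2 *: 'X) * (type_poly s)^`()).
Proof.
move=> s2; have := integ_deriv 0 2^-1 ((1 - 2 *: 'X) * type_poly s).
rewrite derivM derivB derivC derivZ derivX sub0r mulNr -scalerAl mul1r.
rewrite integD integN integZ !hornerM type_poly0 // hornerD hornerN.
rewrite !hornerZ !hornerX hornerC hornerD hornerN hornerZ hornerX hornerC /half_integ; lra.
Qed.

(** The product rule reduces the claim to one factor, where [p_l - (1 - 2x) p_(l-1) = x (1 - x)
    p_(l-2)] is nonnegative. *)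
Lemma deriv_type_poly_ge s x : all (leq 2) s -> 0 <= x <= 2^-1 ->
  - (sumn s)%:R * (type_poly s).[x] <= (1 - 2 * x) * (type_poly s)^`().[x].
Proof.
move=> + x01; elim: s => [|l s IHs] /=.
  by rewrite /type_poly big_nil derivC !horner0 mulr0 oppr0 mul0r.
move=> /andP[l2 /IHs {}IHs].
rewrite type_poly_cons derivM hornerD !hornerM deriv_cycle_poly hornerZ.
set P := (type_poly s).[x] in IHs *; set P' := (_^`()).[x] in IHs *.
have P0 : 0 <= P by apply: type_poly_ge0.
have cl := cycle_poly_ge0 l x01.
have H : - l%:R * (cycle_poly l).[x] <= - l%:R * ((1 - 2 * x) * (cycle_poly l.-1).[x]).
  rewrite !mulNr lerN2 ler_wpM2l // -subr_ge0.
  case: l l2 {cl} => [|[|l]] //= _; move/andP: (x01) => [x0 x1].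
  have -> : (cycle_poly l.+2).[x] - (1 - 2 * x) * (cycle_poly l.+1).[x] =
    x * (1 - x) * (cycle_poly l).[x].
    by rewrite !horner_cycle_poly !exprSr; ring.
  by rewrite !mulr_ge0 ?cycle_poly_ge0 //; lra.
move: IHs (ler_wpM2r P0 H) => /(ler_wpM2l cl).
rewrite natrD; lra.
Qed.

Lemma half_integ_ge s : all (leq 2) s ->
  2 / ((sumn s)%:R + 2) <= half_integ (type_poly s).
Proof.
move=> s2; rewrite ler_pdivrMr; last by rewrite ltr_wpDl.
have: - (sumn s)%:R * integ 0 2^-1 (type_poly s) <=
    integ 0 2^-1 ((1 - 2 *: 'X) * (type_poly s)^`()).
  rewrite -integZ; apply: le_integ => [|x x01]; first lra.
  rewrite hornerZ hornerM !hornerE; exact: deriv_type_poly_ge.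
have := half_integ_parts s2; rewrite /half_integ; lra.
Qed.

(** Again factor by factor: [p_3 p_(l-1) - (1 - 2x) p_l] is [(x (1 - x))^2 p_(l-3)] for [l >= 3] and
    [x (1 - x)] for [l = 2]. *)
Lemma deriv_type_poly_le s x : all (leq 2) s -> 0 <= x <= 2^-1 ->
  (cycle_poly 3).[x] * (type_poly s)^`().[x] <=
    - (sumn s)%:R * ((1 - 2 * x) * (type_poly s).[x]).
Proof.
move=> + x01; elim: s => [|l s IHs] /=.
  by rewrite /type_poly big_nil derivC !horner0 mulr0 oppr0 mul0r.
move=> /andP[l2 /IHs {}IHs].
rewrite type_poly_cons; set c3 := (cycle_poly 3).[x] in IHs *.
rewrite derivM hornerD !hornerM deriv_cycle_poly hornerZ.
set P := (type_poly s).[x] in IHs *; set P' := (_^`()).[x] in IHs *.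
have P0 : 0 <= P by apply: type_poly_ge0.
have cl := cycle_poly_ge0 l x01.
have H : - l%:R * (c3 * (cycle_poly l.-1).[x]) <=
         - l%:R * ((1 - 2 * x) * (cycle_poly l).[x]).
  rewrite /c3 !mulNr lerN2 ler_wpM2l // -subr_ge0; move/andP: (x01) => [x0 x1].
  case: l l2 {cl} => [|[|[|l]]] //= _.
    rewrite !horner_cycle_poly.
    suff : 0 <= x * (1 - x) by rewrite !exprS expr0; lra.
    by rewrite mulr_ge0 //; lra.
  have -> : (cycle_poly 3).[x] * (cycle_poly l.+2).[x]
      - (1 - 2 * x) * (cycle_poly l.+3).[x] =
    (x * (1 - x)) ^+ 2 * (cycle_poly l).[x].
    by rewrite !horner_cycle_poly !exprSr expr0; ring.
  by rewrite mulr_ge0 ?cycle_poly_ge0 // sqr_ge0.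
move: IHs (ler_wpM2r P0 H) => /(ler_wpM2l cl).
rewrite natrD; lra.
Qed.

Lemma half_integ_cons3 s : all (leq 2) s ->
  (1 + 2 / 3 * (sumn s + 3)%:R) * half_integ (type_poly (3%N :: s)) <=
  1 + (sumn s + 3)%:R / 6 * half_integ (type_poly s).
Proof.
move=> s2.
(* With [n = sumn s + 3] and [Q = type_poly s], [deriv_type_poly_le] and [p_2 = 1 - 2X] bound the
   left integrand by [- n (1 - 2x)^2 Q], and [(1 - 2x)^2 = (4 p_3 - 1) / 3]. *)
have: integ 0 2^-1 ((1 - 2 *: 'X) * (type_poly (3%N :: s))^`()) <=
   integ 0 2^-1 (- (4 / 3 * (sumn s + 3)%:R) *: type_poly (3%N :: s)
                  + ((sumn s + 3)%:R / 3) *: type_poly s).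
  apply: le_integ => [|x x01]; first lra.
  rewrite type_poly_cons derivM deriv_cycle_poly /= hornerM !hornerD !hornerM !hornerZ.
  rewrite !hornerM !hornerE /=.
  have w0 : 0 <= 1 - 2 * x by lra.
  have := ler_wpM2l w0 (deriv_type_poly_le s2 x01).
  rewrite !horner_cycle_poly natrD !exprS expr0; nra.
rewrite integD !integZ; have /half_integ_parts := (s2 : all (leq 2) (3%N :: s)).
by rewrite /half_integ; lra.
Qed.

(** [p_l] is the derivative of [- p_(l+1) / (l + 1)], and [p_(l+1)] is 1 at 0 and nonnegative at
    1/2. *)
Lemma half_integ_single l : (0 < l)%N ->
  half_integ (type_poly [:: l]) <= 2 / (l%:R + 1).
Proof.
move=> l0; rewrite /half_integ /type_poly big_seq1 natr1.
have := integ_deriv 0 2^-1 (cycle_poly l.+1).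
rewrite deriv_cycle_poly integZ /= [X in _ - X]horner_cycle_poly.
rewrite subr0 expr1n oppr0 expr0n /= subr0 => E.
have := @cycle_poly_ge0 l.+1 2^-1 ltac:(lra).
rewrite ler_pdivlMr ?ltr0n //; lra.
Qed.

(** Here the product is a power of [1 - 2X], for which the derivative bound behind [half_integ_ge]
    is an equality. *)
Lemma half_integ_twos s : all (pred1 2%N) s ->
  half_integ (type_poly s) = 2 / ((sumn s)%:R + 2).
Proof.
move=> s2; have s2' : all (leq 2) s by apply: sub_all s2 => l /eqP ->.
have E : (1 - 2 *: 'X) * (type_poly s)^`() = - (sumn s)%:R *: type_poly s.
  elim: s s2 {s2'} => [|l s IHs] /=.
    by rewrite /type_poly big_nil derivC mulr0 oppr0 scale0r.
  move=> /andP[/eqP-> /IHs {}IHs].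
  rewrite type_poly_cons derivM mulrDr [X in _ + X]mulrCA IHs deriv_cycle_poly.
  rewrite [cycle_poly _.-1](_ : _ = 1); last by rewrite /cycle_poly !expr1; ring.
  rewrite [cycle_poly 2](_ : _ = 1 - 2 *: 'X); last first.
    by rewrite /cycle_poly scaler_nat; ring.
  by rewrite natrD -scalerAl mul1r -!scalerAr -scalerDl -opprD.
have := half_integ_parts s2'; rewrite E integZ /half_integ => H.
have n0 : (sumn s)%:R + 2 != 0 :> R by rewrite gt_eqF // ltr_wpDl.
by apply: (mulIf n0); rewrite divfK //; lra.
Qed.

(* Two cycle lengths a >= 3 and b >= 2 are replaced by 3 and a + b - 3. *)
Lemma cycle_poly_exchange a b x : 0 <= x <= 2^-1 ->
  (cycle_poly a.+3).[x] * (cycle_poly b.+2).[x] <=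
  (cycle_poly 3).[x] * (cycle_poly (a + b).+2).[x].
Proof.
move=> x01; rewrite -subr_ge0; move/andP: (x01) => [x0 x1].
have w0 : 0 <= x * (1 - x) by rewrite mulr_ge0 //; lra.
(* The difference is [(x (1 - x))^3 p_a p_(b-1)]; for [b = 0] this holds with
   [p_(-1) = 1 / (x (1 - x))], hence the separate case. *)
case: b => [|b].
  have -> : (cycle_poly 3).[x] * (cycle_poly (a + 0).+2).[x] -
    (cycle_poly a.+3).[x] * (cycle_poly 2).[x] =
    (x * (1 - x)) ^+ 2 * (cycle_poly a).[x].
    by rewrite addn0 !horner_cycle_poly !exprSr !expr0; ring.
  by rewrite mulr_ge0 ?cycle_poly_ge0 // sqr_ge0.
have -> : (cycle_poly 3).[x] * (cycle_poly (a + b.+1).+2).[x] -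
  (cycle_poly a.+3).[x] * (cycle_poly b.+3).[x] =
  (x * (1 - x)) ^+ 3 * (cycle_poly a).[x] * (cycle_poly b).[x].
  by rewrite addnS !horner_cycle_poly !exprSr !exprD !expr0; ring.
by rewrite 2?mulr_ge0 ?cycle_poly_ge0 ?exprn_ge0.
Qed.

Lemma half_integ_exchange a b s :
  half_integ (type_poly [:: a.+3, b.+2 & s]) <=
  half_integ (type_poly [:: 3, (a + b).+2 & s]%N).
Proof.
rewrite ler_wpM2l //; apply: le_integ => [|x x01]; first lra.
rewrite !type_poly_cons !hornerM !mulrA ler_wpM2r ?type_poly_ge0 //.
exact: cycle_poly_exchange.
Qed.

Lemma eq_half_integ s t : perm_eq s t ->
  half_integ (type_poly s) = half_integ (type_poly t).
Proof. by move=> st; rewrite /type_poly (perm_big _ st). Qed.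

(* The induction from n - 3 to n with the bound 2 / (n + 19/29) fails for
   n < 10, hence the sharper initial values. At n = 9 the bound is attained,
   by three cycles of length 3. *)
Definition type_bound (n : nat) : R :=
  match n with
  | 2 | 3 => 1 / 2 | 4 => 2 / 5 | 5 => 1 / 3 | 6 => 3 / 10
  | _ => 2 / (n%:R + 19 / 29)
  end.

Arguments type_bound : simpl never.

(** The numerical part of the induction from [n] to [n + 3]. For [n <= 6] the tabulated values are
    inserted; from 7 on the difference is a quotient whose numerator is linear in [y = n - 7] with
    positive coefficients. *)
Lemma type_boundS n b : (2 <= n)%N -> b <= type_bound n ->
  (1 + 2 / 3 * (n + 3)%:R) * type_bound (n + 3) >= 1 + (n + 3)%:R / 6 * b.
Proof.
rewrite addn3; case: n => [|[|[|[|[|[|[|n]]]]]]] // _; rewrite /type_bound => bn; try lra.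
- by rewrite (_ : 2 / (7 + 19 / 29) = 58 / 222); [lra | field].
- by rewrite (_ : 2 / (8 + 19 / 29) = 58 / 251); [lra | field].
(* For [n = 6] and [b = 3/10] both sides equal 29/20; this equality determines the constant
   19/29. *)
- by rewrite (_ : 2 / (9 + 19 / 29) = 58 / 280); [lra | field].
 have E7 : n.+4.+3%:R = n%:R + 7 :> R by rewrite -[n.+4.+3]/(7 + n)%N natrD addrC.
have E10 : n.+2.+4.+4%:R = n%:R + 10 :> R.
  by rewrite -[n.+2.+4.+4]/(10 + n)%N natrD addrC.
rewrite E7 E10 in bn *; have n0 := ler0n R n; move: (n%:R : R) n0 bn => y y0 bn.
apply: (@le_trans _ _ (1 + (y + 10) / 6 * (2 / (y + 7 + 19 / 29)))).
  by rewrite lerD2l ler_wpM2l //; lra.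
have y1 : 0 < y + 7 + 19 / 29 by lra.
have y2 : 0 < y + 10 + 19 / 29 by lra.
rewrite -subr_ge0.
have -> : (1 + 2 / 3 * (y + 10)) * (2 / (y + 10 + 19 / 29)) -
  (1 + (y + 10) / 6 * (2 / (y + 7 + 19 / 29))) =
  (y * (10 / 29) + 248 / 841) / ((y + 10 + 19 / 29) * (y + 7 + 19 / 29)).
  by field; rewrite ?gt_eqF; lra.
by rewrite divr_ge0 // ?mulr_ge0; lra.
Qed.

(** Strong induction on the sum. If all lengths are 2, the value is known exactly, and a single
    length [a >= 3] is covered by [half_integ_single]. Otherwise [a] and a second length are
    exchanged for 3 and a length at least 2, and removing the 3 lowers the sum by 3. *)
Lemma half_integ_bound s : all (leq 2) s ->
  half_integ (type_poly s) <= type_bound (sumn s).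
Proof.
have [n] := ubnP (sumn s); elim: n s => // n IHn s lt_s_n s2.
have [|/allPn[a as_ a2]] := boolP (all (pred1 2%N) s).
  move/half_integ_twos->; move: (sumn s) => {lt_s_n} k.
  have k0 := ler0n R k.
  case: k k0 => [|[|[|[|[|[|[|k]]]]]]] k0; rewrite /type_bound;
    first [by rewrite ler_pM2l // lef_pV2 ?posrE; lra | by rewrite ler_pdivrMr; lra].
have a3 : (2 < a)%N by rewrite ltn_neqAle eq_sym a2 (allP s2).
have Es := perm_to_rem as_; move: (rem a s) Es => s1 Es.
rewrite (eq_half_integ Es); have Esum := perm_sumn Es; rewrite Esum /= in lt_s_n *.
rewrite (perm_all _ Es) /= in s2.
case/andP: s2 => _ s2; move: lt_s_n; have -> : a = (a - 3).+3 by lia.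
move: (a - 3)%N => {as_ a3 a2 Es Esum} {}a lt_s_n.
case: s1 s2 lt_s_n => [|b s1] /= => [_ _|/andP[b2 s2] lt_s_n].
  apply: le_trans (half_integ_single _) _ => //; rewrite addn0.
  have k0 := ler0n R a.+3.
  case: a k0 => [|[|[|[|a]]]] k0; rewrite /type_bound;
    first [by rewrite ler_pM2l // lef_pV2 ?posrE; lra | by rewrite ler_pdivrMr; lra].
case: b b2 lt_s_n => [|[|b]] // _ lt_s_n.
apply: le_trans (half_integ_exchange _ _ _) _.
have mu2 : all (leq 2) [:: (a + b).+2 & s1] by [].
have -> : (a.+3 + (b.+2 + sumn s1) = sumn [:: (a + b).+2 & s1] + 3)%N.
  by rewrite /=; lia.
have mu_n : (sumn [:: (a + b).+2 & s1] < n)%N by rewrite /=; lia.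
have mu_gt1 : (1 < sumn [:: (a + b).+2 & s1])%N by [].
have := le_trans (half_integ_cons3 mu2) (type_boundS mu_gt1 (IHn _ mu_n mu2)).
by rewrite ler_pM2l // ltr_wpDr // mulr_ge0 // divr_ge0.
Qed.

Lemma half_integ_le s : all (leq 2) s ->
  half_integ (type_poly s) <= 2 / ((sumn s)%:R + 19 / 29).
Proof.
move=> /half_integ_bound /le_trans-> //.
by case: (sumn s) => [|[|[|[|[|[|[|k]]]]]]] //; rewrite /type_bound ler_pdivlMr; lra.
Qed.

End CyclePoly.

(** * The integral formula *)

Section IntegralFormula.
Variables (R : rcfType) (T : finType).
Implicit Types (A S : {set T}) (D : {perm T}) (J : {set {set T}}).

Definition porbits_in A D := [set C in porbits D | C \subset A].

Lemma porbits_trivIset D : trivIset (porbits D).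
Proof.
apply/trivIsetP=> B C Bo Co; apply: contraNT => /pred0Pn[x /andP[/= xB xC]].
by rewrite (porbit_in_porbits Bo xB) (porbit_in_porbits Co xC).
Qed.

Lemma porbits_in_sub A D : porbits_in A D \subset porbits D.
Proof. by apply/subsetP=> C; rewrite inE => /andP[]. Qed.

Lemma cover_porbits_in A D : stable A D -> cover (porbits_in A D) = A.
Proof.
move=> As; apply/setP=> x; apply/bigcupP/idP=> [[C /setIdP[_ /subsetP CA] /CA]//|xA].
by exists (porbit D x); rewrite ?porbit_id // inE imset_f ?stable_porbit_sub.
Qed.

Lemma stable_cover D J : J \subset porbits D -> stable (cover J) D.
Proof.
move=> /subsetP JD; apply: stable_sub => x /bigcupP[C CJ xC].
apply/bigcupP; exists C => //; have := JD C CJ; rewrite -/porbits => Co.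
by rewrite (porbit_in_porbits Co xC) (stableP _ _ (porbit_stable _ _)) porbit_id.
Qed.

Lemma porbits_in_cover D J : J \subset porbits D -> porbits_in (cover J) D = J.
Proof.
move=> JD; apply/setP=> C; rewrite inE; apply/andP/idP=> [[]|CJ]; last first.
  by rewrite (subsetP JD) // bigcup_sup.
move=> /imsetP[x _ ->]; rewrite stable_porbit_sub ?stable_cover // => /bigcupP[C' C'J xC'].
by rewrite -(porbit_in_porbits (subsetP JD _ C'J) xC').
Qed.

Lemma card_cover_porbits D J : J \subset porbits D -> #|cover J| = (\sum_(C in J) #|C|)%N.
Proof. by move=> JD; apply/esym/eqP; apply: trivIsetS JD (porbits_trivIset D). Qed.

(** Expanding the product chooses [- (- X)^#|C|] or [(1 - X)^#|C|] for each cycle [C]. The cycles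
    with the first choice form a set [J] with stable union [S], and [(-1)^(#|J| + #|S|)] is the sign
    of [D] on [S]. *)
Lemma prod_cycle_poly A D : perm_on A D ->
  \prod_(C in porbits_in A D) cycle_poly R #|C| =
  \sum_(S : {set T} | S \subset A)
     (stable_sign D S)%:~R *: ('X^#|S| * (1 - 'X) ^+ (#|A| - #|S|)).
Proof.
move=> AD; have As := perm_on_stable AD; set Q := porbits_in A D.
have QD : Q \subset porbits D := porbits_in_sub A D.
(* The defaults 0 and 1 let the product range over all sets [C], as [bigA_distr] requires. *)
pose F C : {poly R} := if C \in Q then - (- 'X) ^+ #|C| else 0.
pose G C : {poly R} := if C \in Q then (1 - 'X) ^+ #|C| else 1.
transitivity (\prod_(C : {set T}) (F C + G C)).
  rewrite big_mkcond; apply: eq_bigr => C _; rewrite /F /G.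
  by case: ifP => _; rewrite ?add0r // addrC.
rewrite bigA_distr (bigID (fun J => J \subset Q)) /= [X in _ + X]big1 ?addr0; last first.
  move=> J /subsetPn[C CJ CQ]; rewrite (bigD1 C) //= CJ /F (negPf CQ) mul0r //.
rewrite [RHS](bigID (fun S => stable S D)) /= [X in _ = _ + X]big1 ?addr0; last first.
  by move=> S /andP[_ /negPf Ss]; rewrite /stable_sign Ss scale0r.
rewrite (reindex_onto (fun S => porbits_in S D) (@cover T)) /=; last first.
  by move=> J JQ; rewrite porbits_in_cover // (subset_trans JQ QD).
apply: eq_big => S.
  apply/andP/andP=> [[SQ /eqP ES]|[SA Ss]]; last first.
    rewrite cover_porbits_in // eqxx; split=> //; apply/subsetP=> C.
    by rewrite !inE => /andP[-> /subset_trans->].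
  have Ss : stable S D by rewrite -ES stable_cover // porbits_in_sub.
  split=> //; rewrite -ES; apply/bigcupsP=> C CJ.
  by have := subsetP SQ C CJ; rewrite inE => /andP[].
move=> /andP[SQ /eqP ES]; set J := porbits_in S D in SQ ES *.
have JD : J \subset porbits D := porbits_in_sub S D.
have Ss : stable S D by rewrite -ES stable_cover.
rewrite (bigID (fun C => C \in J)) /=.
have -> : \prod_(C | C \in J) (if C \in J then F C else G C) = (-1) ^+ #|J| * (- 'X) ^+ #|S|.
  rewrite -[in RHS]ES (card_cover_porbits JD) -prodr_const expr_sum -big_split /=.
  by apply: eq_bigr => C CJ; rewrite CJ /F (subsetP SQ _ CJ) mulN1r.
have -> : \prod_(C | C \notin J) (if C \in J then F C else G C) = (1 - 'X) ^+ (#|A| - #|S|).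
  have -> : (#|A| - #|S| = \sum_(C in Q :\: J) #|C|)%N.
    rewrite -(cover_porbits_in As) (card_cover_porbits QD) -[in X in (_ - X)%N]ES.
    by rewrite (card_cover_porbits JD) (big_setID J) /= (setIidPr SQ) addKn.
  rewrite expr_sum big_mkcond [RHS]big_mkcond; apply: eq_bigr => C _.
  by rewrite in_setD /G; case: (C \in J).
rewrite /stable_sign Ss odd_restr // -[num_porbits_in S D]/#|J|.
rewrite signr_addb !signr_odd rmorphM !rmorphXn /= rmorphN1 -mul_polyC rmorphM !rmorphXn rmorphN1.
by rewrite [(- 'X) ^+ _]exprNn !mulrA [_ ^+ #|J| * _]mulrC.
Qed.

(** By the beta integral, the term of [S] integrates to its term in [num_full_formula] divided by
    [(#|A| + 1)!]. *)
Lemma integ_prod_cycle_poly A D : perm_on A D -> A != set0 ->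
  integ 0 1 (\prod_(C in porbits_in A D) cycle_poly R #|C|) =
  (num_full A D)%:R / (#|A|.-1)`!%:R.
Proof.
move=> AD A0; have n0 : (0 < #|A|)%N by rewrite card_gt0.
apply: (@mulIf _ (#|A|.+1)`!%:R); first by rewrite pnatr_eq0 -lt0n fact_gt0.
transitivity ((#|A|.+1 * #|A| * num_full A D)%:R : R); last first.
  have -> : (#|A|.+1)`! = (#|A|.+1 * #|A| * (#|A|.-1)`!)%N.
    by rewrite factS -{2}(prednK n0) factS prednK // mulnA.
  have f0 : (#|A|.-1)`!%:R != 0 :> R by rewrite pnatr_eq0 -lt0n fact_gt0.
  by rewrite [in RHS]natrM [X in _ * X]mulrC mulrA divfK // -natrM mulnC.
transitivity (((#|A|.+1 * #|A| * num_full A D)%:R : int)%:~R : R); last by rewrite natz.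
rewrite num_full_formula // prod_cycle_poly // integ_sum mulr_suml rmorph_sum /=.
apply: eq_bigr => S SA; rewrite integZ -mulrA.
have := @integ_beta R #|S| (#|A| - #|S|); rewrite subnKC ?subset_leq_card // => ->.
by rewrite [RHS]rmorphM [RHS]mulrC natz.
Qed.

End IntegralFormula.

(** * Symmetry about 1/2 and removal of fixed points *)

Section Bounds.
Variables (R : rcfType).

Lemma cycle_poly_reflect l :
  cycle_poly R l \Po (1 - 'X) = (-1) ^+ l.+1 *: cycle_poly R l.
Proof.
rewrite /cycle_poly rmorphB /= !rmorphXn /= rmorphB rmorphN rmorph1 /= comp_polyX.
have -> : 1 - (1 - 'X) = 'X :> {poly R} by rewrite opprB addrC subrK.
have -> : - (1 - 'X) = -1 * (1 - 'X) :> {poly R} by rewrite mulN1r.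
have E : ((-1) ^+ l.+1)%:P = (-1) ^+ l.+1 :> {poly R} by rewrite polyC_exp polyCN polyC1.
rewrite -mul_polyC E exprMn (exprNn 'X) mulrBr mulrA -exprD addSn addnn.
have -> : (-1) ^+ l.*2.+1 = -1 :> {poly R} by rewrite exprS -mul2n exprM sqrrN !expr1n mulr1.
by rewrite mulN1r opprK addrC exprS mulN1r mulNr.
Qed.

(** Reflection multiplies [p_l] by [(-1)^(l+1)], and [sumn s + size s] is the sum of the [l + 1]; it
    is even when a permutation with these cycle lengths is even. *)
Lemma type_poly_reflect s : ~~ odd (sumn s + size s) ->
  type_poly R s \Po (1 - 'X) = type_poly R s.
Proof.
suff -> : type_poly R s \Po (1 - 'X) = (-1) ^+ (sumn s + size s) *: type_poly R s.
  by rewrite -signr_odd => /negPf->; rewrite scale1r.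
elim: s => [|l s IHs] /=; first by rewrite /type_poly big_nil rmorph1 scale1r.
rewrite type_poly_cons rmorphM /= IHs cycle_poly_reflect -scalerAl -scalerAr scalerA.
by congr (_ *: _); rewrite -exprD; congr (_ ^+ _); lia.
Qed.

Lemma integ_half_integ (p : {poly R}) : p \Po (1 - 'X) = p ->
  integ 0 1 p = half_integ p.
Proof.
move=> pR; rewrite (integ_split 0 2^-1 1) /half_integ -{2}pR integ_reflect.
have -> : 1 - 1 = 0 :> R by lra.
have -> : 1 - 2^-1 = 2^-1 :> R by lra.
by rewrite mulr_natl mulr2n.
Qed.

Lemma type_poly_filter s : all (leq 1) s -> type_poly R (filter (leq 2) s) = type_poly R s.
Proof.
elim: s => //= l s IHs /andP[l1 /IHs {}IHs]; rewrite [RHS]type_poly_cons -IHs.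
case: ltnP => l2; first by rewrite type_poly_cons.
have -> : l = 1%N by lia.
by rewrite /cycle_poly !expr1 opprK subrK mul1r.
Qed.

Lemma sumn_filter s : all (leq 1) s -> (sumn (filter (leq 2) s) + count_mem 1 s = sumn s)%N.
Proof.
elim: s => //= l s IHs /andP[l1 /IHs <-]; case: ltnP => l2 /=.
  by rewrite gtn_eqF // add0n addnA.
have -> : l = 1%N by lia.
by rewrite eqxx addnCA.
Qed.

Variable T : finType.
Implicit Types (A : {set T}) (D : {perm T}).

Definition porbit_sizes A D := [seq #|C| | C : {set T} <- enum (porbits_in A D)].

Lemma porbit_sizes_gt0 A D : all (leq 1) (porbit_sizes A D).
Proof.
apply/allP=> l /mapP[C]; rewrite mem_enum inE => /andP[/imsetP[x _ ->] _] ->.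
by rewrite lt0n card_porbit_neq0.
Qed.

Lemma sumn_porbit_sizes A D : perm_on A D -> sumn (porbit_sizes A D) = #|A|.
Proof.
move=> AD; rewrite sumnE big_map big_enum /= -(card_cover_porbits (porbits_in_sub A D)).
by rewrite cover_porbits_in // perm_on_stable.
Qed.

Lemma size_porbit_sizes A D : size (porbit_sizes A D) = num_porbits_in A D.
Proof. by rewrite size_map -cardE. Qed.

Lemma count_porbit_sizes A D : count_mem 1 (porbit_sizes A D) = num_cycles A D 1.
Proof.
rewrite count_map /num_cycles cardE -size_filter; apply: perm_size; apply: uniq_perm.
- by rewrite filter_uniq ?enum_uniq.
- exact: enum_uniq.
by move=> C; rewrite mem_filter !mem_enum !inE /= andbC andbA.
Qed.

Lemma type_poly_porbit_sizes A D :
  type_poly R (porbit_sizes A D) = \prod_(C in porbits_in A D) cycle_poly R #|C|.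
Proof. by rewrite /type_poly big_map big_enum. Qed.

Lemma num_full_bounds A D : perm_on A D -> A != set0 -> ~~ odd_perm D ->
  2 / (#|A|%:R - (num_cycles A D 1)%:R + 2) <= (num_full A D)%:R / (#|A|.-1)`!%:R :> R
  /\ (num_full A D)%:R / (#|A|.-1)`!%:R
     <= 2 / (#|A|%:R - (num_cycles A D 1)%:R + 19 / 29) :> R.
Proof.
move=> AD A0 Deven; pose s := filter (leq 2) (porbit_sizes A D).
have s1 := porbit_sizes_gt0 A D.
have s2 : all (leq 2) s by apply: filter_all.
have -> : #|A|%:R - (num_cycles A D 1)%:R = (sumn s)%:R :> R.
  by rewrite -(sumn_porbit_sizes AD) -sumn_filter // count_porbit_sizes natrD addrK.
have <- : half_integ (type_poly R s) = (num_full A D)%:R / (#|A|.-1)`!%:R.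
  rewrite type_poly_filter // -integ_prod_cycle_poly // -type_poly_porbit_sizes.
  apply/esym/integ_half_integ/type_poly_reflect.
  rewrite sumn_porbit_sizes // size_porbit_sizes oddD -odd_restr ?perm_on_stable //.
  by rewrite /restr_odd restr_perm_on_id.
by split; [apply: half_integ_ge | apply: half_integ_le].
Qed.

End Bounds.

Theorem theorem3p3 (m : nat) (G : graph m) (e : cmap m)
    (eG : embedding_of G e) (e1 : one_face e)
    (nu : {set 'I_(2 * m)}) (nuG : nu \in vertices G) :
  (forall (k : nat) (a : nat -> nat),
     k = deg nu ->
     has_cycle_type k nu (diagonal e nu) a ->
     2%:R / ((deg nu)%:R - (a 1%N)%:R + 2%:R) <= prob1 e nu
     /\ prob1 e nu <= 2%:R / ((deg nu)%:R - (a 1%N)%:R + 19%:R / 29%:R))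
  /\ 2%:R / ((deg nu)%:R + 2%:R) <= prob1 e nu.
Proof.
have nu_vertex : nu \in porbits (vertex_perm e) by case: eG => _ ->.
have nu0 := vertex_neq0 nu_vertex.
pose a1 := num_cycles nu (diagonal e nu) 1.
have [lo up] : 2%:R / ((deg nu)%:R - a1%:R + 2%:R) <= prob1 e nu
     /\ prob1 e nu <= 2%:R / ((deg nu)%:R - a1%:R + 19%:R / 29%:R).
  (* Monotonicity of the integral uses a real closed field, so the bounds are taken over [realalg]
     and brought back to the rationals through [ratr]. *)
  have [] := num_full_bounds realalg (diagonal_on e nu) nu0 (diagonal_even e1 nu_vertex).
  rewrite /prob1 card_reembeddings // -/a1 => lo up.
  split; rewrite -(ler_rat realalg) [ratr (_%:R / (_.-1)`!%:R)]fmorph_div !rmorph_nat.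
    by rewrite fmorph_div (rmorph_nat _ 2) rmorphD rmorphB !rmorph_nat.
  by rewrite fmorph_div (rmorph_nat _ 2) rmorphD rmorphB fmorph_div !rmorph_nat.
split=> [k a Ek type_a|].
  have -> : a 1%N = a1 by rewrite -type_a // Ek /= /deg card_gt0.
  by split.
(* The lower bound grows with [a1] as long as [a1] is at most the degree, so replacing [a1] by 0
   weakens it. *)
have le_a1 : (a1 <= deg nu)%N.
  by rewrite /a1 /deg -count_porbit_sizes -(sumn_porbit_sizes (diagonal_on e nu))
    -(sumn_filter (porbit_sizes_gt0 _ _)) leq_addl.
apply: le_trans lo; rewrite ler_pM2l // lef_pV2 ?posrE ?ltr_wpDl //.
  by rewrite lerD2r gerBl ler0n.
by rewrite subr_ge0 ler_nat.
Qed.
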